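(* Let $p\in(2,6)$, $\mu>0$, and let $\mathcal{G}$ be a metric graph not homeomorphic to $\mathbb{R}$ in which $N\ge2$ half-lines emanate from the same vertex $v$. Let $u$ be a ground state of mass $\mu$ on $\mathcal{G}$ with $u>0$. Then there exist $m>0$ and $y\ge0$ such that on each of these $N$ half-lines (with coordinate $x\ge0$, $x=0$ at $v$) one has $u(x)=\phi_m(x+y)$ for all $x\ge0$, with the same $y$ for all $N$ half-lines.
   Context: A metric graph $\mathcal{G}$ is a connected graph with finitely many edges, each identified with a bounded interval $[0,\ell_e]$ or a half-line $[0,+\infty)$ (attached at $0$), glued at vertices. $H^1(\mathcal{G})$ consists of real continuous functions which are $H^1$ on each edge with finite $H^1$ norm; $E(u,\mathcal{G})=\frac12\int_{\mathcal{G}}|u'|^2-\frac1p\int_{\mathcal{G}}|u|^p$; $H^1_\mu(\mathcal{G})=\{u\in H^1(\mathcal{G}):\|u\|_{L^2}^2=\mu\}$; a ground state of mass $\mu$ is a minimizer of $E$ on $H^1_\mu(\mathcal{G})$. $\phi_m$ is the soliton of mass $m$: $\phi_m(x)=m^\alpha\phi_1(m^\beta x)$, $\alpha=\frac2{6-p}$, $\beta=\frac{p-2}{6-p}$, $\phi_1(x)=C\,\mathrm{sech}(cx)^{\alpha/\beta}$ with constants $C,c>0$ depending on $p$, the positive even minimizer of $E(\cdot,\mathbb{R})$ on $H^1_m(\mathbb{R})$. *)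

(* Defs.v *)
From HB Require Import structures.
From mathcomp Require Import all_boot all_order all_algebra.
From mathcomp Require Import all_classical all_reals all_analysis.
Set Implicit Arguments. Unset Strict Implicit. Unset Printing Implicit Defensive.
Import Order.TTheory GRing.Theory Num.Theory.
Import numFieldNormedType.Exports.
Local Open Scope classical_set_scope.
Local Open Scope ring_scope.

Section MetricGraphs.
Variable R : realType.
Local Notation leb := (@lebesgue_measure R).

(** Combinatorial data of a metric graph: vertices 'I_nV, bounded edges
    'I_nB (edge e is [0, len e], 0 glued to bsrc e, len e glued to btgt e),
    half-lines 'I_nH (half-line h is [0,+oo), 0 glued to hsrc h).
    Loops and multiple edges are allowed. *)
Record mgraph := MGraph {
  nV : nat; nB : nat; nH : nat;
  len : 'I_nB -> R;
  bsrc : 'I_nB -> 'I_nV;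
  btgt : 'I_nB -> 'I_nV;
  hsrc : 'I_nH -> 'I_nV }.
Arguments len : clear implicits.
Arguments bsrc : clear implicits.
Arguments btgt : clear implicits.
Arguments hsrc : clear implicits.

Definition gadj (G : mgraph) : rel 'I_(nV G) := fun x y =>
  [exists e : 'I_(nB G), ((bsrc G e == x) && (btgt G e == y))
                       || ((bsrc G e == y) && (btgt G e == x))].

Definition is_metric_graph (G : mgraph) : Prop :=
  (0 < nV G)%N /\ (forall e, 0 < len G e) /\
  (forall x y : 'I_(nV G), connect (@gadj G) x y).

Definition gdeg (G : mgraph) (x : 'I_(nV G)) : nat :=
  (#|[set e | bsrc G e == x]| + #|[set e | btgt G e == x]|
   + #|[set h | hsrc G h == x]|)%N.

(** G is homeomorphic to R  (combinatorial characterization) *)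
Definition homeo_R (G : mgraph) : Prop :=
  nH G = 2%N /\ forall x, @gdeg G x = 2%N.

Definition set_cc (a b : R) : set R := `[a, b]%classic.

Definition set_ci0 : set R := `[0%R, +oo[%classic.

(** H^1 on an interval D (containing 0) with weak derivative g:
    f, g in L^2(D), and f is the primitive of g (absolutely continuous). *)
Definition H1_int (D : set R) (f g : R -> R) : Prop :=
  measurable_fun D f /\ measurable_fun D g /\
  (\int[leb]_(x in D) ((f x) ^+ 2)%:E < +oo)%E /\
  (\int[leb]_(x in D) ((g x) ^+ 2)%:E < +oo)%E /\
  (forall x, D x ->
     (0 <= x -> ((f x - f 0)%:E = \int[leb]_(t in set_cc 0 x) (g t)%:E)%E) /\
     (x <= 0 -> ((f 0 - f x)%:E = \int[leb]_(t in set_cc x 0) (g t)%:E)%E)).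

(** a function on G: one real function per bounded edge and per half-line
    (only values on the edge's interval matter) *)
Record gfun (G : mgraph) := GFun {
  fB : 'I_(nB G) -> R -> R;
  fH : 'I_(nH G) -> R -> R }.

Definition gH1 (G : mgraph) (u du : gfun G) : Prop :=
  (exists val : 'I_(nV G) -> R,
     (forall e, fB u e 0 = val (bsrc G e) /\ fB u e (len G e) = val (btgt G e)) /\
     (forall h, fH u h 0 = val (hsrc G h))) /\
  (forall e, H1_int (set_cc 0 (len G e)) (fB u e) (fB du e)) /\
  (forall h, H1_int set_ci0 (fH u h) (fH du h)).

Definition sqr (t : R) : R := t ^+ 2.
Definition abspow (p t : R) : R := `|t| `^ p.

Definition gint (G : mgraph) (F : R -> R) (u : gfun G) : \bar R :=
  (\sum_(e < nB G) \int[leb]_(x in set_cc 0 (len G e)) (F (fB u e x))%:E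
   + \sum_(h < nH G) \int[leb]_(x in set_ci0) (F (fH u h x))%:E)%E.

Definition gmass (G : mgraph) (u : gfun G) : \bar R := gint sqr u.

Definition genergy (p : R) (G : mgraph) (u du : gfun G) : \bar R :=
  ((2^-1)%:E * gint sqr du - (p^-1)%:E * gint (abspow p) u)%E.

Definition ground_state (p mu : R) (G : mgraph) (u du : gfun G) : Prop :=
  gH1 u du /\ gmass u = mu%:E /\
  forall v dv : gfun G, gH1 v dv -> gmass v = mu%:E ->
    (genergy p u du <= genergy p v dv)%E.

Definition gpos (G : mgraph) (u : gfun G) : Prop :=
  (forall e x, 0 <= x <= len G e -> 0 < fB u e x) /\
  (forall h x, 0 <= x -> 0 < fH u h x).

Definition Rmass (f : R -> R) : \bar R := \int[leb]_(x in setT) ((f x) ^+ 2)%:E.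
Definition Renergy (p : R) (f df : R -> R) : \bar R :=
  ((2^-1)%:E * \int[leb]_(x in setT) ((df x) ^+ 2)%:E
   - (p^-1)%:E * \int[leb]_(x in setT) (`|f x| `^ p)%:E)%E.

Definition soliton1 (p : R) (phi : R -> R) : Prop :=
  exists dphi, H1_int setT phi dphi /\ Rmass phi = 1%E /\
  (forall x, 0 < phi x) /\ (forall x, phi (- x) = phi x) /\
  forall f df, H1_int setT f df -> Rmass f = 1%E ->
    (Renergy p phi dphi <= Renergy p f df)%E.

Definition soliton_m (p : R) (phi1 : R -> R) (m x : R) : R :=
  m `^ (2 / (6 - p)) * phi1 (m `^ ((p - 2) / (6 - p)) * x).

End MetricGraphs.

Arguments len {R} m _.
Arguments bsrc {R} m _.
Arguments btgt {R} m _.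
Arguments hsrc {R} m _.

(* Main.v *)
Require Import Defs.
From HB Require Import structures.
From mathcomp Require Import all_boot all_order all_algebra.
From mathcomp Require Import all_classical all_reals all_analysis.
From mathcomp Require Import measurable_realfun ring lra.
Import Order.TTheory GRing.Theory Num.Theory.
Import numFieldNormedType.Exports.
Set Implicit Arguments.
Unset Strict Implicit.
Unset Printing Implicit Defensive.

(** Perturbing a ground state [u] by piecewise linear functions supported inside
    a half-line, and rescaling to restore the mass, shows that [u] solves
    [u'' = lam u - u^(p-1)] there, with one multiplier [lam] for the whole
    graph.  Since [u] vanishes at infinity its first integral is zero, hence
    [lam > 0], and [u^(-(p-2)/2)] solves a linear equation; being positive it is
    a multiple of [cosh (c (x + y))].  The same applies to the soliton on the
    line, where evenness forces [y = 0].  So [u] on each half-line at [v] is a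
    translate of the same [phi_m], and the value at [v] determines [|y|].

    If [y < 0] on some half-line, [u] exceeds there its value at [v].  Join this
    half-line with another one at [v] into a line, multiply [u] by [sqrt t] on
    the line and by [sqrt s] on the (nonempty) rest of the graph, keeping the
    mass fixed, and slide the line so as to restore continuity at [v].  The
    energy is affine minus [t^(p/2) B / p + s^(p/2) B' / p], hence strictly
    concave along this family, which passes through the minimizer [u] at an
    interior point: a contradiction. *)

Local Open Scope classical_set_scope.
Local Open Scope ring_scope.

(** * Square integrable functions and H^1 on an interval *)

Section SquareIntegrable.
Variable R : realType.
Local Notation leb := (@lebesgue_measure R).
Implicit Types (D E : set R) (f g h : R -> R).

(** The power term enters the energy with a minus sign and [|t|^p] is convex, so tangent lines bound
    the energy of every competitor from above. Hence [powR_bernoulli] and [abspow_tangent] take the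
    place of differentiation under the integral sign. Tents suffice as test functions because a weak
    derivative paired with a step function only sees increments of [u]; a tent inside [[0, +oo)]
    vanishes at [0], so the values at the vertices stay fixed. In the exchange of mass the
    parameters are [t] and [s] instead of the amplitudes: mass and kinetic energy become linear, and
    the power terms carry the exponent [p / 2 > 1]. Continuity at [v] asks the slide to reach the
    value [sqrt (s / t) u(v)]. Smaller values than [u(v)] are always attained, since [u] vanishes at
    infinity; larger ones require that [u] exceed [u(v)] somewhere, and this is where [y < 0]
    enters. Both directions are needed for the two opposite signs that contradict each other. The
    exchange also needs a partner with positive mass, which is what excludes the line. *)

Definition rint D f := leb.-integrable D (EFin \o f).
(** Measurability is a separate clause because that of [f ^+ 2] does not imply that of [f]. *)
Definition sqint D f := measurable_fun D f /\ rint D (fun x => f x ^+ 2).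

Lemma rint_measurable D f : rint D f -> measurable_fun D f.
Proof. by move=> /integrableP[/measurable_EFinP]. Qed.

Lemma rint_le D f g : measurable D -> measurable_fun D f -> rint D g ->
  (forall x, D x -> `|f x| <= g x) -> rint D f.
Proof.
move=> mD mf ig fg; apply: le_integrable ig => //; first exact/measurable_EFinP.
by move=> x Dx /=; rewrite lee_fin (le_trans (fg x Dx)) ?ler_norm.
Qed.

Lemma rint_sub D E f : measurable D -> measurable E -> D `<=` E ->
  rint E f -> rint D f.
Proof. by move=> mD mE DE; exact: integrableS. Qed.

Lemma rintD D f g : measurable D -> rint D f -> rint D g ->
  rint D (fun x => f x + g x).
Proof.
by move=> mD fi gi; exact: (@integrableD _ _ _ leb _ mD _ _ fi gi).
Qed.

Lemma rintZ D c f : measurable D -> rint D f -> rint D (fun x => c * f x).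
Proof.
by move=> mD fi; exact: (@integrableZl _ _ _ leb _ mD c _ fi).
Qed.

Lemma rint_eq D f g : measurable D -> (forall x, D x -> f x = g x) ->
  rint D f -> rint D g.
Proof.
by move=> mD fg; apply: (@eq_integrable _ _ _ leb _ mD) => x /set_mem Dx; rewrite /= fg.
Qed.

Lemma Rint_eq D f g : (forall x, D x -> f x = g x) ->
  \int[leb]_(x in D) f x = \int[leb]_(x in D) g x.
Proof. by move=> fg; apply: eq_Rintegral => x /set_mem; exact: fg. Qed.

Lemma rint_EFin D f : measurable D -> rint D f ->
  (\int[leb]_(x in D) (f x)%:E = (\int[leb]_(x in D) f x)%:E)%E.
Proof. by move=> mD fi; rewrite /Rintegral fineK//; exact: integrable_fin_num. Qed.

Lemma rint_lty D f : measurable D -> measurable_fun D f -> (forall x, D x -> 0 <= f x) ->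
  (\int[leb]_(x in D) (f x)%:E < +oo)%E -> rint D f.
Proof.
move=> mD mf f0 fi; apply/integrableP; split; first exact/measurable_EFinP.
apply: le_lt_trans fi; rewrite le_eqVlt; apply/orP; left; apply/eqP.
by apply: eq_integral => x /set_mem Dx /=; rewrite ger0_norm ?f0.
Qed.

Lemma rint_cst (a b c : R) : rint `[a, b] (fun=> c).
Proof.
apply: continuous_compact_integrable; first exact: segment_compact.
by apply: continuous_subspaceT => x; exact: cvg_cst.
Qed.

Lemma Rint_cst (a b c : R) : a <= b -> \int[leb]_(x in `[a, b]) c = c * (b - a).
Proof.
move=> ab; rewrite Rintegral_cst//= lebesgue_measure_itv/= lte_fin.
by case: ltgtP ab => // -> _; rewrite subrr.
Qed.

Lemma sqint_mul D f g : measurable D -> sqint D f -> sqint D g ->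
  rint D (fun x => f x * g x).
Proof.
move=> mD [mf fi] [mg gi].
apply: (rint_le mD _ (rintD mD fi gi)); first exact: measurable_funM.
move=> x Dx; rewrite normrM -(real_normK (num_real (f x))) -(real_normK (num_real (g x))).
by have := sqr_ge0 (`|f x| - `|g x|); nra.
Qed.

Lemma sqintD D f g : measurable D -> sqint D f -> sqint D g ->
  sqint D (fun x => f x + g x).
Proof.
move=> mD sf sg; split; first by apply: measurable_funD; [case: sf|case: sg].
have h := rintD mD (rintD mD sf.2 (rintZ 2 mD (sqint_mul mD sf sg))) sg.2.
by apply: rint_eq h => // x _; ring.
Qed.

Lemma sqintZ D c f : measurable D -> sqint D f -> sqint D (fun x => c * f x).
Proof.
move=> mD [mf fi]; split; first exact: measurable_funM.
by apply: rint_eq (rintZ (c ^+ 2) mD fi) => // x _; ring.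
Qed.

Lemma sqint_sub D E f : measurable D -> measurable E -> D `<=` E ->
  sqint E f -> sqint D f.
Proof.
move=> mD mE DE [mf fi]; split; first exact: measurable_funS mf.
exact: rint_sub fi.
Qed.

Lemma sqint_rint (a b : R) f : sqint `[a, b] f -> rint `[a, b] f.
Proof.
move=> [mf fi]; apply: (rint_le _ mf (rintD _ (rint_cst a b 1) fi)) => // x _.
rewrite -(real_normK (num_real (f x))).
by have := sqr_ge0 (`|f x| - 1); nra.
Qed.

Lemma Rint_sqrD D f h e : measurable D -> sqint D f -> sqint D h ->
  \int[leb]_(x in D) (f x + e * h x) ^+ 2 =
  \int[leb]_(x in D) f x ^+ 2 + 2 * e * \int[leb]_(x in D) (f x * h x)
  + e ^+ 2 * \int[leb]_(x in D) h x ^+ 2.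
Proof.
move=> mD sf sh; have fh := sqint_mul mD sf sh.
rewrite -RintegralZl// -RintegralZl//; last exact: sh.2.
have h1 := rintZ (2 * e) mD fh; have h2 := rintZ (e ^+ 2) mD sh.2.
rewrite -RintegralD//; last exact: sf.2.
rewrite -RintegralD//; last exact: rintD mD sf.2 h1.
by apply: Rint_eq => x _; ring.
Qed.

Lemma Rint_setU (a b c : R) f : a <= b -> b <= c -> rint `[a, c] f ->
  \int[leb]_(x in `[a, c]) f x =
  \int[leb]_(x in `[a, b]) f x + \int[leb]_(x in `[b, c]) f x.
Proof.
move=> ab bc fi.
have := @Rintegral_itvB _ f (BLeft a) (BRight c) b fi.
rewrite !bnd_simp => /(_ ab bc) /eqP; rewrite subr_eq addrC => /eqP ->.
congr (_ + _); rewrite Rintegral_itv_obnd_cbnd//.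
apply: rint_sub fi => //; apply: subset_itv; rewrite bnd_simp//.
Qed.

(** A real-valued form of [H1_int] for an interval [D]: the primitive formula
    no longer singles out the base point [0]. *)
Definition H1on D f g := [/\ sqint D f, sqint D g &
  forall x y, D x -> D y -> x <= y ->
    f y - f x = \int[leb]_(t in `[x, y]) g t].

Lemma is_interval_cc D (x y : R) : is_interval D -> D x -> D y -> `[x, y] `<=` D.
Proof. by move=> iD Dx Dy z /=; rewrite in_itv/=; exact: iD. Qed.

Lemma H1on_H1_int D f g : measurable D -> is_interval D -> D 0 ->
  H1on D f g -> H1_int D f g.
Proof.
move=> mD iD D0 [[mf fi] sg fg]; have [mg gi] := sg.
split=> //; split=> //; split; first by rewrite rint_EFin// ltry.
split; first by rewrite rint_EFin// ltry.
move=> x Dx; split=> x0; rewrite fg// /set_cc rint_EFin//;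
  apply: sqint_rint; apply: sqint_sub sg => //; exact: is_interval_cc.
Qed.

Lemma H1_int_H1on D f g : measurable D -> is_interval D -> D 0 ->
  H1_int D f g -> H1on D f g.
Proof.
move=> mD iD D0 [mf [mg [fi [gi fg]]]].
have sf : sqint D f.
  by split=> //; apply: rint_lty => //; [exact: measurable_funX|move=> x _; exact: sqr_ge0].
have sg : sqint D g.
  by split=> //; apply: rint_lty => //; [exact: measurable_funX|move=> x _; exact: sqr_ge0].
have gii x y : D x -> D y -> rint `[x, y] g.
  by move=> Dx Dy; apply: sqint_rint; apply: sqint_sub sg => //; exact: is_interval_cc.
have fp x : D x -> 0 <= x -> f x - f 0 = \int[leb]_(t in `[0, x]) g t.
  by move=> Dx x0; have [/(_ x0)+ _] := fg _ Dx; rewrite /set_cc rint_EFin//; [case|exact: gii].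
have fm x : D x -> x <= 0 -> f 0 - f x = \int[leb]_(t in `[x, 0]) g t.
  by move=> Dx x0; have [_ /(_ x0)] := fg _ Dx; rewrite /set_cc rint_EFin//; [case|exact: gii].
split=> // x y Dx Dy xy.
have [x0|/ltW x0] := leP 0 x.
  have y0 := le_trans x0 xy.
  by have := Rint_setU x0 xy (gii _ _ D0 Dy); rewrite -!fp//; lra.
have [y0|/ltW y0] := leP 0 y.
  by have := Rint_setU x0 y0 (gii _ _ Dx Dy); rewrite -fp// -fm//; lra.
by have := Rint_setU xy y0 (gii _ _ Dx D0); rewrite -!fm//; lra.
Qed.

Lemma H1onD D f g f' g' : measurable D -> is_interval D ->
  H1on D f g -> H1on D f' g' -> H1on D (fun x => f x + f' x) (fun x => g x + g' x).
Proof.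
move=> mD iD [sf sg fg] [sf' sg' fg']; split; [exact: sqintD|exact: sqintD|].
move=> x y Dx Dy xy; have sD := is_interval_cc iD Dx Dy.
rewrite RintegralD//; [|by apply/sqint_rint/(sqint_sub _ mD)..].
by rewrite -fg// -fg'//; ring.
Qed.

Lemma H1onZ D c f g : measurable D -> is_interval D ->
  H1on D f g -> H1on D (fun x => c * f x) (fun x => c * g x).
Proof.
move=> mD iD [sf sg fg]; split; [exact: sqintZ|exact: sqintZ|].
move=> x y Dx Dy xy; have sD := is_interval_cc iD Dx Dy.
rewrite RintegralZl//; last by apply/sqint_rint/(sqint_sub _ mD).
by rewrite -fg//; ring.
Qed.

Lemma H1on_sub D E f g : measurable D -> measurable E -> D `<=` E ->
  H1on E f g -> H1on D f g.
Proof.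
move=> mD mE DE [sf sg fg]; split; [exact: (sqint_sub mD mE)|exact: (sqint_sub mD mE)|].
by move=> x y Dx Dy; apply: fg; exact: DE.
Qed.

Lemma Rint_sub_ge0 D E f : measurable D -> measurable E -> D `<=` E ->
  rint E f -> (forall x, E x -> 0 <= f x) ->
  \int[leb]_(x in D) f x <= \int[leb]_(x in E) f x.
Proof.
move=> mD mE DE fi f0; rewrite -lee_fin -!rint_EFin//; last exact: rint_sub fi.
apply: ge0_subset_integral => //.
by case/integrableP: fi.
Qed.

Lemma Rint_sqr_ge0 D f : 0 <= \int[leb]_(x in D) f x ^+ 2.
Proof. by apply: Rintegral_ge0 => x _; exact: sqr_ge0. Qed.

(* Young's inequality with parameter [d] turns the primitive formula into a modulus of continuity. *)
Lemma H1on_modulus D f g x y (d : R) : measurable D -> is_interval D -> H1on D f g ->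
  D x -> D y -> x <= y -> 0 < d ->
  `|f y - f x| <= (y - x) / d + d * \int[leb]_(t in D) g t ^+ 2.
Proof.
move=> mD iD [sf sg fg] Dx Dy xy d0.
have sD := is_interval_cc iD Dx Dy.
have sg' : sqint `[x, y] g by exact: (sqint_sub _ mD).
rewrite fg//; apply: le_trans (le_normr_Rintegral _ (sqint_rint sg')) _ => //.
apply: (@le_trans _ _ (\int[leb]_(t in `[x, y]) (d^-1 + d * g t ^+ 2))).
  apply: le_Rintegral => //.
  - by apply: integrable_norm => //; exact: sqint_rint.
  - by apply: rintD => //; [exact: rint_cst|apply: rintZ => //; case: sg'].
  - move=> t _; rewrite -(real_normK (num_real (g t))).
    set a := `|g t|; have e : d * d^-1 = 1 by rewrite divff// gt_eqF.
    have di : 0 < d^-1 by rewrite invr_gt0.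
    have : 0 <= d * (a - d^-1) ^+ 2 by rewrite mulr_ge0 ?sqr_ge0// ltW.
    have a0 : 0 <= a by exact: normr_ge0.
    rewrite (_ : d * (a - d^-1) ^+ 2 = d * a ^+ 2 - 2 * a * (d * d^-1) + d^-1 * (d * d^-1)); last by ring.
    rewrite e; lra.
rewrite RintegralD//; [|exact: rint_cst|by apply: rintZ => //; case: sg'].
rewrite Rint_cst// RintegralZl//; last by case: sg'.
rewrite mulrC lerD2l ler_pM2l//.
by apply: Rint_sub_ge0 => //; [case: sg|move=> *; exact: sqr_ge0].
Qed.
End SquareIntegrable.

(** * Convexity of powers; boundedness and decay of H^1 functions *)

Section Powers.
Variable R : realType.
Local Notation leb := (@lebesgue_measure R).
Implicit Types (D : set R) (f g : R -> R) (p q s t x : R).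

(** By the mean value theorem the chord between [t] and [1] has slope [q c^(q-1)] with [c] strictly
    between them, which lies on the right side of [q]. Strictness is what finally contradicts
    minimality in [concave_step]. *)
Lemma powR_bernoulli_lt q t : 1 < q -> 0 < t -> t != 1 -> 1 + q * (t - 1) < t `^ q.
Proof.
move=> q1 t0 t1.
have dp x : 0 < x -> is_derive x (1 : R) (@powR R ^~ q) (q * x `^ (q - 1)).
  exact: is_derive1_powR.
have cp a b : 0 < a -> {within `[a, b], continuous (@powR R ^~ q)}.
  move=> a0; apply: derivable_within_continuous => x.
  rewrite in_itv/= => /andP[ax _].
  by have [] := dp x (lt_le_trans a0 ax).
have [tlt|tgt|/eqP] := ltgtP t 1; last by rewrite (negbTE t1).
- have [|c] := @MVT R _ (fun x => q * x `^ (q - 1)) _ _ tlt _ (cp _ _ t0).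
    by move=> x; rewrite in_itv/= => /andP[tx _]; exact: dp (lt_trans t0 tx).
  rewrite in_itv/= => /andP[tc c1]; rewrite /= powR1 => e.
  have c0 := lt_trans t0 tc.
  have : c `^ (q - 1) < 1.
    have := gt0_ltr_powR (_ : 0 < q - 1) => /(_ ltac:(lra)) h.
    have := h c 1; rewrite !nnegrE => /(_ (ltW c0) ler01 c1).
    by rewrite powR1.
  set k := c `^ _ in e * => k1.
  have : 0 < q * (1 - k) * (1 - t) by rewrite !mulr_gt0//; lra.
  lra.
- have [|c] := @MVT R _ (fun x => q * x `^ (q - 1)) _ _ tgt _ (cp _ _ ltr01).
    by move=> x; rewrite in_itv/= => /andP[tx _]; exact: dp (lt_trans ltr01 tx).
  rewrite in_itv/= => /andP[c1 tc]; rewrite /= powR1 => e.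
  have : 1 < c `^ (q - 1).
    have := gt0_ltr_powR (_ : 0 < q - 1) => /(_ ltac:(lra)) h.
    have := h 1 c; rewrite !nnegrE => /(_ ler01 (ltW (lt_trans ltr01 c1)) c1).
    by rewrite powR1.
  set k := c `^ _ in e * => k1.
  have : 0 < q * (k - 1) * (t - 1) by rewrite !mulr_gt0//; lra.
  lra.
Qed.

Lemma powR_bernoulli q t : 1 < q -> 0 <= t -> 1 + q * (t - 1) <= t `^ q.
Proof.
move=> q1; rewrite le_eqVlt => /predU1P[<-|t0].
  by rewrite powR0; [lra|rewrite gt_eqF//; lra].
have [->|t1] := eqVneq t 1; first by rewrite powR1; lra.
exact/ltW/powR_bernoulli_lt.
Qed.

(** Homogeneity reduces this to Bernoulli at [|t| / s], and then [t <= |t|]. Negative [t] must be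
    covered, since a perturbation of a positive function may change sign. *)
Lemma abspow_tangent p s t : 1 < p -> 0 < s ->
  s `^ p + p * s `^ (p - 1) * (t - s) <= abspow p t.
Proof.
move=> p1 s0; rewrite /abspow.
have s0' := ltW s0; have p0 : 0 < p by lra.
have -> : `|t| = s * (`|t| / s) by rewrite mulrCA divff ?mulr1// gt_eqF.
rewrite powRM ?divr_ge0// -mulr_powRB1//.
have b := powR_bernoulli p1 (divr_ge0 (normr_ge0 t) (ltW s0)).
have k0 : 0 < s `^ (p - 1) by exact: powR_gt0.
set k := s `^ _ in k0 *; set z := _ `^ p in b *.
have : 0 <= s * k * (z - (1 + p * (`|t| / s - 1))).
  by apply: mulr_ge0; [apply: mulr_ge0; exact: ltW|rewrite subr_ge0].
have -> : s * k * (z - (1 + p * (`|t| / s - 1))) =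
  s * k * z - s * k - p * k * ((s / s) * `|t|) + p * k * s by ring.
rewrite divff ?gt_eqF// mul1r.
have : p * k * t <= p * k * `|t|.
  by rewrite ler_pM2l ?ler_norm// mulr_gt0//; lra.
nra.
Qed.

Lemma abspow_ge0 p t : 0 <= abspow p t.
Proof. exact: powR_ge0. Qed.

Lemma abspowM p s t : abspow p (s * t) = abspow p s * abspow p t.
Proof. by rewrite /abspow normrM powRM. Qed.

Lemma abspow_le_sqr p (K t : R) : 2 < p -> `|t| <= K -> abspow p t <= K `^ (p - 2) * t ^+ 2.
Proof.
move=> p2 tK; rewrite /abspow.
have -> : `|t| `^ p = `|t| `^ (p - 2) * `|t| `^ 2%:R.
  rewrite -powRD; first by congr powR; ring.
  by apply/implyP => /eqP; lra.
rewrite powR_mulrn// real_normK ?num_real//.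
apply: ler_wpM2r; first exact: sqr_ge0.
have h := @ge0_ler_powR R (p - 2) ltac:(lra).
by apply: h => //; rewrite nnegrE// (le_trans _ tK).
Qed.

Lemma measurable_abspow D p f : measurable D -> measurable_fun D f ->
  measurable_fun D (fun x => abspow p (f x)).
Proof.
move=> mD mf; apply: (measurableT_comp (f := fun y : R => y `^ p)) => //.
exact: measurableT_comp.
Qed.

Definition bounded_on D f := exists K, forall x, D x -> `|f x| <= K.

Lemma rint_abspow D p f : measurable D -> 2 < p -> sqint D f -> bounded_on D f ->
  rint D (fun x => abspow p (f x)).
Proof.
move=> mD p2 [mf fi] [K fK].
apply: (rint_le mD (measurable_abspow p mD mf) (rintZ (K `^ (p - 2)) mD fi)).
by move=> x Dx; rewrite ger0_norm ?abspow_ge0// abspow_le_sqr// fK.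
Qed.

Lemma H1on_bounded_cc (a b : R) f g : H1on `[a, b] f g -> bounded_on `[a, b] f.
Proof.
move=> fg; exists (`|f a| + ((b - a) + \int[leb]_(t in `[a, b]) g t ^+ 2)) => x xab.
have := xab; rewrite /= in_itv/= => /andP[ax xb].
have Da : `[a, b]%classic a by rewrite /= in_itv/= lexx (le_trans ax).
have := H1on_modulus (measurable_itv _) (@interval_is_interval _ _) fg Da xab ax ltr01.
rewrite divr1 mul1r; have := ler_normD (f x - f a) (f a).
rewrite subrK; lra.
Qed.

(** If [|f x| > 2 + I + M], the modulus of continuity with [d = 1] keeps [|f| >= 1 + M] on
    [[x, x + 1]], whose mass would then be at least [(1 + M)^2 > M]. Closure under [x + 1] covers
    the half-line and the line at once. *)
Lemma H1on_bounded_shift D f g : measurable D -> is_interval D ->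
  (forall x, D x -> D (x + 1)) -> H1on D f g -> bounded_on D f.
Proof.
move=> mD iD D1 fg.
set M := \int[leb]_(t in D) f t ^+ 2; set I := \int[leb]_(t in D) g t ^+ 2.
have M0 : 0 <= M by exact: Rint_sqr_ge0.
exists (2 + I + M) => x Dx; rewrite leNgt; apply/negP => fx.
have [sf _ _] := fg.
have sD := is_interval_cc iD Dx (D1 _ Dx).
have : (1 + M) ^+ 2 * (x + 1 - x) <= M.
  rewrite -Rint_cst; last by lra.
  apply: le_trans (_ : \int[leb]_(t in `[x, x + 1]) f t ^+ 2 <= _).
    apply: le_Rintegral => //; first exact: rint_cst.
      exact: (rint_sub _ mD sD sf.2).
    move=> t tx; have Dt := sD _ tx; move: tx; rewrite /= in_itv/= => /andP[xt tx].
    have := H1on_modulus mD iD fg Dx Dt xt ltr01; rewrite divr1 mul1r -/I => h.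
    have := ler_normB (f t) (f t - f x); rewrite (_ : f t - (f t - f x) = f x); last by ring.
    move=> h'; rewrite -(real_normK (num_real (f t))).
    have : 1 + M <= `|f t| by lra.
    nra.
  apply: Rint_sub_ge0 => //; [exact: sf.2|by move=> *; exact: sqr_ge0].
nra.
Qed.

(** A value above [e] at [x] forces a fixed amount of mass just to the right of [x], more than is
    left in a distant tail. *)
Lemma H1on_vanishes f g : H1on (@set_ci0 R) f g ->
  forall e, 0 < e -> exists2 X, 0 <= X & forall x, X <= x -> `|f x| <= e.
Proof.
move=> fg e e0; have [sf _ _] := fg.
have mD : measurable (@set_ci0 R) by exact: measurable_itv.
have iD : is_interval (@set_ci0 R) by exact: interval_is_interval.
have Dp x : 0 <= x -> set_ci0 x by move=> x0; rewrite /set_ci0/= in_itv/= x0.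
set I := \int[leb]_(t in @set_ci0 R) g t ^+ 2.
have I0 : 0 <= I by exact: Rint_sqr_ge0.
(* With this [d] the function moves by at most [d + d * I = e / 2] over a length [d ^+ 2], so
   [|f| >= e / 2] there; [eta] is the resulting mass. *)
pose d := e / (2 * (1 + I)).
have d0 : 0 < d by rewrite divr_gt0// mulr_gt0//; lra.
have dI : d + d * I = e / 2.
  rewrite (_ : d + d * I = d * (1 + I)); last by ring.
  by rewrite /d; field; rewrite gt_eqF//; lra.
pose eta := (e / 2) ^+ 2 * d ^+ 2.
have eta0 : 0 < eta by rewrite mulr_gt0// exprn_gt0// divr_gt0.
pose F (n : nat) := `[0 : R, n%:R]%classic.
have F_ci : \bigcup_n F n = @set_ci0 R.
  apply/seteqP; split => x /=.
    by move=> [n _]; rewrite /F/= in_itv/= => /andP[x0 _]; exact: Dp.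
  rewrite /set_ci0/= in_itv/= andbT => x0.
  exists (Num.bound x) => //; rewrite /F/= in_itv/= x0 ltW//.
  exact: archi_boundP.
have FD n : F n `<=` @set_ci0 R by rewrite -F_ci; exact: bigcup_sup.
have mF n : measurable (F n) by exact: measurable_itv.
have cvgF : (\int[leb]_(x in F n) (f x ^+ 2)%:E)%E @[n --> \oo] -->
    (\int[leb]_(x in @set_ci0 R) (f x ^+ 2)%:E)%E.
  rewrite -F_ci; apply: ge0_nondecreasing_set_cvg_integral.
  - move=> m n mn; rewrite subsetEset; apply: subset_itv; rewrite bnd_simp//.
    by rewrite ler_nat.
  - by move=> n; exact: measurable_itv.
  - move=> n; apply/measurable_EFinP; apply: measurable_funX.
    exact: (measurable_funS mD (FD n) sf.1).
  - by move=> n x _; rewrite lee_fin sqr_ge0.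
(* Otherwise all integrals over [F n], hence their limit, would stay [eta] below the total. *)
have [n hn] : exists n : nat, \int[leb]_(x in @set_ci0 R) f x ^+ 2 - eta <
    \int[leb]_(x in F n) f x ^+ 2.
  apply: contrapT => /forallNP h.
  have : (\int[leb]_(x in @set_ci0 R) (f x ^+ 2)%:E <=
     (\int[leb]_(x in @set_ci0 R) f x ^+ 2 - eta)%:E)%E.
    rewrite -(cvg_lim (@ereal_hausdorff R) cvgF); apply: lime_le; first by apply/cvg_ex; eexists; exact: cvgF.
    apply: nearW => n.
    rewrite rint_EFin//; last exact: (rint_sub (mF n) mD (FD n) sf.2).
    by rewrite lee_fin leNgt; apply/negP; exact: h.
  rewrite rint_EFin//; last exact: sf.2.
  by rewrite lee_fin lerBrDr gerDl leNgt eta0.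
(* The extra [1] puts [[x, x + d ^+ 2]] inside the open tail []n, +oo[]. *)
exists (n%:R + 1) => [|x nx]; first by rewrite addr_ge0.
rewrite leNgt; apply/negP => fx.
have x0 : 0 <= x by apply: le_trans nx; rewrite addr_ge0.
have := @Rintegral_itvB R (fun x => f x ^+ 2) (BLeft 0) +oo%O n%:R sf.2.
rewrite !bnd_simp => /(_ (ler0n _ _) isT) => tail.
have le1 : \int[leb]_(t in `[x, x + d ^+ 2]) f t ^+ 2 <= \int[leb]_(t in `]n%:R, +oo[) f t ^+ 2.
  apply: Rint_sub_ge0 => //; last by move=> *; exact: sqr_ge0.
    apply: subset_itv; rewrite bnd_simp//; lra.
  apply: rint_sub sf.2 => //; apply: subset_itv; rewrite bnd_simp//.
have le2 : eta <= \int[leb]_(t in `[x, x + d ^+ 2]) f t ^+ 2.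
  rewrite /eta -[X in _ * X](_ : x + d ^+ 2 - x = _); last by ring.
  rewrite -Rint_cst; last by rewrite lerDl sqr_ge0.
  apply: le_Rintegral => //; first exact: rint_cst.
    apply: rint_sub sf.2 => //; apply: subset_itv; rewrite bnd_simp//.
  move=> t; rewrite /= in_itv/= => /andP[xt tx].
  have := H1on_modulus mD iD fg (Dp _ x0) (Dp _ (le_trans x0 xt)) xt d0.
  rewrite -/I => h.
  have : (t - x) / d <= d by rewrite ler_pdivrMr//; lra.
  have := ler_normB (f t) (f t - f x); rewrite (_ : f t - (f t - f x) = f x); last by ring.
  move=> h' h2; rewrite -(real_normK (num_real (f t))).
  have : e / 2 <= `|f t| by lra.
  nra.
by move: hn tail; rewrite /set_ci0 /F => hn tail; lra.
Qed.

End Powers.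

(** * Regularity of weak solutions *)

Section Calculus.
Variable R : realType.
Local Notation leb := (@lebesgue_measure R).
Implicit Types (f g F G d h : R -> R) (a b c x y z k p lam : R).

Lemma der_eq f x a b : is_derive x 1 f a -> a = b -> is_derive x 1 f b.
Proof. by move=> df <-. Qed.

Lemma derD f g x a b : is_derive x 1 f a -> is_derive x 1 g b ->
  is_derive x 1 (fun t => f t + g t) (a + b).
Proof. by move=> *; exact: is_deriveD. Qed.

Lemma derM f g x a b : is_derive x 1 f a -> is_derive x 1 g b ->
  is_derive x 1 (fun t => f t * g t) (f x * b + g x * a).
Proof. by move=> *; exact: is_deriveM. Qed.

Lemma derZ k f x a : is_derive x 1 f a -> is_derive x 1 (fun t => k * f t) (k * a).
Proof. by move=> *; exact: is_deriveZ. Qed.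

Lemma der_cst k x : is_derive x 1 (fun=> k : R) 0.
Proof. exact: is_derive_cst. Qed.

Lemma der_id x : is_derive x 1 (fun t : R => t) 1.
Proof. exact: is_derive_id. Qed.

Lemma der_comp f g x a b : is_derive (g x) 1 f a -> is_derive x 1 g b ->
  is_derive x 1 (fun t => f (g t)) (a * b).
Proof. by move=> df dg; exact: is_derive1_comp. Qed.

Lemma der_powR q g x b : 0 < g x -> is_derive x 1 g b ->
  is_derive x 1 (fun t => g t `^ q) (q * g x `^ (q - 1) * b).
Proof. by move=> g0 dg; exact: (der_comp (f := @powR R ^~ q) (is_derive1_powR q g0) dg). Qed.

Lemma der_expRM c x : is_derive x 1 (fun t => expR (c * t)) (c * expR (c * x)).
Proof.
rewrite mulrC; apply: (der_comp (f := @expR R)).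
by apply: (der_eq (derZ c (der_id x))); rewrite mulr1.
Qed.

Lemma der_cst_on z h : (forall x, z <= x -> is_derive x 1 h 0) ->
  forall x, z <= x -> h x = h z.
Proof.
move=> dh x zx.
have [| |c _] := @MVT_segment R h (fun=> 0) _ _ zx.
- by move=> t; rewrite in_itv/= => /andP[/ltW zt _]; exact: dh.
- apply: derivable_within_continuous => t; rewrite in_itv/= => /andP[zt _].
  by have [] := dh _ zt.
- by rewrite mul0r; lra.
Qed.

Lemma Rint_ftc F f a b : a < b ->
  (forall x, a <= x <= b -> is_derive x 1 F (f x) /\ {for x, continuous f}) ->
  \int[leb]_(x in `[a, b]) f x = F b - F a.
Proof.
move=> ab dFf.
have dF x : a <= x <= b -> is_derive x 1 F (f x) by move=> /dFf[].
have cf x : a <= x <= b -> {for x, continuous f} by move=> /dFf[].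
 rewrite /Rintegral (@continuous_FTC2 R f F a b)//.
- by apply: continuous_in_subspaceT => x /set_mem /=; rewrite in_itv/=; exact: cf.
- have dc x : a <= x <= b -> {for x, continuous F}.
    by move=> xab; apply/differentiable_continuous/derivable1_diffP; have [] := dF _ xab.
  split.
  + by move=> x; rewrite in_itv/= => /andP[ax xb]; have [] := dF x; rewrite ?ltW.
  + by apply: cvg_at_right_filter; apply: dc; rewrite lexx ltW.
  + by apply: cvg_at_left_filter; apply: dc; rewrite lexx ltW.
- move=> x; rewrite in_itv/= => /andP[ax xb].
  have [|_ <-] := dF x; first by rewrite !ltW.
  by rewrite derive1E.
Qed.

Lemma primitive_derive f z x : (forall t, z <= t -> {for t, continuous f}) ->
  z < x -> is_derive x 1 (fun x => \int[leb]_(t in `[z, x]) f t) (f x).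
Proof.
move=> cf zx.
have x1 : x < x + 1 by rewrite ltrDl.
have [] := @continuous_FTC1_closed R f z x (x + 1) x1 _ zx (cf _ (ltW zx)).
  apply: continuous_compact_integrable; first exact: segment_compact.
  apply: continuous_in_subspaceT => t /set_mem /=; rewrite in_itv/= => /andP[zt _].
  exact: cf.
by move=> dF e; split; [exact: dF|rewrite -derive1E].
Qed.

Definition slope f a b := (f b - f a) / (b - a).

(** The pairing of [G] with the hat function that is [1] at [b] and [0] at [a] and [c], that is, the
    right-hand side of the weak equation. *)
Definition tentint G a b c :=
  \int[leb]_(x in `[a, b]) (G x * ((x - a) / (b - a))) +
  \int[leb]_(x in `[b, c]) (G x * ((c - x) / (c - b))).

(* A second primitive [Q] of [G] satisfies the same identities up to sign, by
   integration by parts, so that [f + Q] has equal slopes, i.e. is affine. *)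
Lemma weak_solution_regular f G z :
  (forall x, {for x, continuous G}) ->
  (forall a b c, z <= a -> a < b -> b < c ->
     slope f a b - slope f b c = tentint G a b c) ->
  exists F d, [/\ forall x, z <= x -> F x = f x,
    forall x, z <= x -> is_derive x 1 F (d x) &
    forall x, z <= x -> is_derive x 1 d (- G x)].
Proof.
move=> cG eqf.
(* The primitives start to the left of [z], so that two-sided derivatives exist at [z] itself. *)
pose P x := \int[leb]_(t in `[z - 2, x]) G t.
have dP x : z - 2 < x -> is_derive x 1 P (G x).
  by move=> zx; exact: primitive_derive.
have cP x : z - 2 < x -> {for x, continuous P}.
  by move=> zx; apply/differentiable_continuous/derivable1_diffP; have [] := dP _ zx.
pose Q x := \int[leb]_(t in `[z - 1, x]) P t.
have dQ x : z - 1 < x -> is_derive x 1 Q (P x).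
  by move=> zx; apply: primitive_derive => // t zt; apply: cP; lra.
have cont_id x : {for x, continuous (fun t : R => t)} by exact: cvg_id.
have eqQ a b c : z <= a -> a < b -> b < c ->
    slope Q a b - slope Q b c = - tentint G a b c.
  move=> za ab bc; rewrite /tentint.
  have ba0 : b - a != 0 by rewrite subr_eq0 gt_eqF.
  have cb0 : c - b != 0 by rewrite subr_eq0 gt_eqF.
  have -> : \int[leb]_(x in `[a, b]) (G x * ((x - a) / (b - a))) =
      P b - (Q b - Q a) / (b - a).
    (* Integration by parts, in the form of an explicit antiderivative built from [P] and [Q]. *)
    rewrite (@Rint_ftc (fun x => P x * ((b - a)^-1 * (x + - a)) + (- (b - a)^-1) * Q x))//.
    + by field.
    + move=> x /andP[ax xb]; split.
      have zx1 : z - 1 < x by lra.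
      have zx2 : z - 2 < x by lra.
      have dd := derD (derM (dP _ zx2) (derZ (b - a)^-1 (derD (der_id x) (der_cst (- a) x))))
        (derZ (- (b - a)^-1) (dQ _ zx1)).
      by apply: (der_eq dd); field.
      apply: cvgM; first exact: cG.
      by apply: cvgM; [apply: cvgB; [exact: cont_id|exact: cvg_cst]|exact: cvg_cst].
  have -> : \int[leb]_(x in `[b, c]) (G x * ((c - x) / (c - b))) =
      - P b + (Q c - Q b) / (c - b).
    rewrite (@Rint_ftc (fun x => P x * ((c - b)^-1 * (c + (-1) * x)) + (c - b)^-1 * Q x))//.
    + by field.
    + move=> x /andP[bx xc]; split.
      have zx1 : z - 1 < x by lra.
      have zx2 : z - 2 < x by lra.
      have dd := derD (derM (dP _ zx2) (derZ (c - b)^-1 (derD (der_cst c x) (derZ (-1) (der_id x)))))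
        (derZ (c - b)^-1 (dQ _ zx1)).
      by apply: (der_eq dd); field.
      apply: cvgM; first exact: cG.
      by apply: cvgM; [apply: cvgB; [exact: cvg_cst|exact: cont_id]|exact: cvg_cst].
  by rewrite /slope; ring.
pose D x := f x + Q x; pose al := D (z + 1) - D z.
have eqD a b c : z <= a -> a < b -> b < c ->
    (D b - D a) * (c - b) = (D c - D b) * (b - a).
  move=> za ab bc.
  have ba0 : b - a != 0 by rewrite subr_eq0 gt_eqF.
  have cb0 : c - b != 0 by rewrite subr_eq0 gt_eqF.
  have := eqf _ _ _ za ab bc; have := eqQ _ _ _ za ab bc.
  move=> h1 h2; have : slope f a b + slope Q a b = slope f b c + slope Q b c by lra.
  rewrite /slope -!mulrDl => /(congr1 (fun t => t * (c - b) * (b - a))).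
  have -> (u v : R) : u / v * (c - b) * (b - a) = u * (v^-1 * ((c - b) * (b - a))) by ring.
  have -> (u v : R) : u / v * (c - b) * (b - a) = u * (v^-1 * ((c - b) * (b - a))) by ring.
  rewrite (_ : (b - a)^-1 * _ = c - b); last by field.
  rewrite (_ : (c - b)^-1 * _ = b - a); last by field.
  by rewrite /D; lra.
have aff x : z <= x -> D x = D z + al * (x - z).
  rewrite le_eqVlt => /predU1P[<-|zx]; first by rewrite subrr mulr0 addr0.
  have [x1|x1|->] := ltgtP x (z + 1); last by rewrite /al; ring.
  - by have := eqD z x (z + 1) (lexx _) zx x1; rewrite /al; lra.
  - have zz : z < z + 1 by rewrite ltrDl.
    by have := eqD z (z + 1) x (lexx _) zz x1; rewrite /al; lra.
(* The affine function minus [Q]: it equals [f] from [z] on and, unlike [f], is differentiable from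
   both sides at [z]. *)
exists (fun x => (D z + al * (x + - z)) + (-1) * Q x), (fun x => al + (-1) * P x); split.
- by move=> x zx; have := aff _ zx; rewrite /D; lra.
- move=> x zx.
  have zx1 : z - 1 < x by lra.
  have dd := derD (derD (der_cst (D z) x) (derZ al (derD (der_id x) (der_cst (- z) x))))
    (derZ (-1) (dQ _ zx1)).
  by apply: (der_eq dd); ring.
- move=> x zx.
  have zx2 : z - 2 < x by lra.
  have dd := derD (der_cst al x) (derZ (-1) (dP _ zx2)).
  by apply: (der_eq dd); ring.
Qed.

End Calculus.

(** * Positive solutions vanishing at infinity *)

Section Profile.
Variable R : realType.
Implicit Types (f g F G d h : R -> R) (a b c x y z k p lam s t : R).

Definition cosh2 t := expR t + expR (- t).

(** In usual notation this is [(p lam / 2)^(1/(p-2)) sech(c t)^(2/(p-2))] with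
    [c = (p-2)/2 sqrt lam]. The parameter is the frequency [lam] and not the mass, because the
    equation supplies [lam]; [cosh2] is twice the hyperbolic cosine. *)
Definition profile p lam t :=
  (Num.sqrt (2 / (p * lam)) / 2 * cosh2 ((p - 2) / 2 * Num.sqrt lam * t)) `^ (- ((p - 2) / 2)^-1).

Lemma cosh2_gt0 t : 0 < cosh2 t.
Proof. by rewrite addr_gt0 ?expR_gt0. Qed.

Lemma cosh2N t : cosh2 (- t) = cosh2 t.
Proof. by rewrite /cosh2 opprK addrC. Qed.

Lemma cosh2_norm t : cosh2 `|t| = cosh2 t.
Proof. by case: (ger0P t) => // _; rewrite cosh2N. Qed.

(** With [a = |s|] and [b = |t|], the difference factors as [(e^b - e^a) (1 - e^(-a) e^(-b))]. *)
Lemma cosh2_lt s t : `|s| < `|t| -> cosh2 s < cosh2 t.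
Proof.
rewrite -(cosh2_norm s) -(cosh2_norm t).
move: `|s| `|t| (normr_ge0 s) => a b a0 ab.
have eab : expR a < expR b by rewrite ltr_expR.
have e1 : expR (- a) * expR (- b) < 1 by rewrite -expRD expR_lt1; lra.
have ea : expR a * expR (- a) = 1 by rewrite -expRD subrr expR0.
have eb : expR b * expR (- b) = 1 by rewrite -expRD subrr expR0.
rewrite /cosh2 -subr_gt0.
rewrite (_ : _ - _ = (expR b - expR a) * (1 - expR (- a) * expR (- b))); last first.
  rewrite (_ : (expR b - expR a) * (1 - expR (- a) * expR (- b)) =
    expR b - expR a - (expR b * expR (- b)) * expR (- a) + (expR a * expR (- a)) * expR (- b)); last by ring.
  by rewrite ea eb; ring.
by rewrite mulr_gt0 ?subr_gt0.
Qed.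

Lemma profile_lt p lam s t : 2 < p -> 0 < lam -> `|s| < `|t| ->
  profile p lam t < profile p lam s.
Proof.
move=> p2 l0 st; have l0' : 0 < Num.sqrt lam by rewrite sqrtr_gt0.
have p0 : 0 < 2 / (p * lam) by rewrite divr_gt0// mulr_gt0//; lra.
have A0 : 0 < Num.sqrt (2 / (p * lam)) / 2 by rewrite divr_gt0// sqrtr_gt0.
have k0 : 0 < ((p - 2) / 2)^-1 by rewrite invr_gt0; lra.
have cst : cosh2 ((p - 2) / 2 * Num.sqrt lam * s) < cosh2 ((p - 2) / 2 * Num.sqrt lam * t).
  have k1 : 0 < (p - 2) / 2 by lra.
  apply: cosh2_lt; rewrite normrM [ltRHS]normrM ltr_pM2l//.
  by rewrite normr_gt0 gt_eqF// mulr_gt0.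
rewrite /profile; set X := _ * cosh2 _; set Y := _ * cosh2 _.
have Y0 : 0 < Y by rewrite mulr_gt0// cosh2_gt0.
have YX : Y < X by rewrite ltr_pM2l.
have X0 := lt_trans Y0 YX.
rewrite !powRN ltf_pV2 ?posrE ?powR_gt0//.
by apply: gt0_ltr_powR => //; rewrite nnegrE ltW.
Qed.

Lemma profile_inj p lam s t : 2 < p -> 0 < lam ->
  profile p lam s = profile p lam t -> `|s| = `|t|.
Proof.
move=> p2 l0 st; have [h|h|//] := ltgtP `|s| `|t|.
  by have := profile_lt p2 l0 h; rewrite st ltxx.
by have := profile_lt p2 l0 h; rewrite st ltxx.
Qed.

(** The equation [w'' = c^2 w] splits into two first order ones, so [(w' + c w) e^(-c x)] and
    [(c w - w') e^(c x)] are constant. Their product is the first integral [r^2 > 0], so they have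
    the same sign, and [w > 0] makes it positive. *)
Lemma cosh_solution c r z w wd : 0 < c -> 0 < r ->
  (forall x, z <= x -> is_derive x 1 w (wd x)) ->
  (forall x, z <= x -> is_derive x 1 wd (c * c * w x)) ->
  (forall x, z <= x -> 0 < w x) ->
  c * c * (w z * w z) - wd z * wd z = r * r ->
  exists y, forall x, z <= x -> w x = r / (2 * c) * cosh2 (c * (x + y)).
Proof.
move=> c0 r0 dw dwd w0 rr; have zz := lexx z.
pose wp x := (wd x + c * w x) * expR ((- c) * x).
pose wm x := (c * w x + (-1) * wd x) * expR (c * x).
have wp_const x : z <= x -> wp x = wp z.
  move: x; apply: der_cst_on => x zx.
  have e := derM (derD (dwd _ zx) (derZ c (dw _ zx))) (der_expRM (- c) x).
  by apply: (der_eq e); ring.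
have wm_const x : z <= x -> wm x = wm z.
  move: x; apply: der_cst_on => x zx.
  have e := derM (derD (derZ c (dw _ zx)) (derZ (-1) (dwd _ zx))) (der_expRM c x).
  by apply: (der_eq e); ring.
have ex t : expR (c * t) * expR ((- c) * t) = 1.
  by rewrite -expRD -mulrDl subrr mul0r expR0.
have sum x : wp x * expR (c * x) + wm x * expR ((- c) * x) = 2 * c * w x.
  rewrite (_ : wp x * _ + _ = (expR (c * x) * expR ((- c) * x)) * (2 * c * w x)).
    by rewrite ex mul1r.
  by rewrite /wp /wm; ring.
have pm : wp z * wm z = r * r.
  rewrite -rr (_ : wp z * _ = (expR (c * z) * expR ((- c) * z)) *
    (c * c * (w z * w z) - wd z * wd z)); first by rewrite ex mul1r.
  by rewrite /wp /wm; ring.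
have rr0 : 0 < r * r by rewrite mulr_gt0.
have wp0 : 0 < wp z.
  rewrite ltNge; apply/negP => wp0.
  have wm0 : wm z <= 0.
    by rewrite leNgt; apply/negP => /ltW wm0; have := mulr_le0_ge0 wp0 wm0; lra.
  have h1 := mulr_le0_ge0 wp0 (expR_ge0 (c * z)).
  have h2 := mulr_le0_ge0 wm0 (expR_ge0 ((- c) * z)).
  have := w0 _ zz; have := sum z; have cw : 0 < 2 * c * w z by rewrite !mulr_gt0// w0.
  lra.
(* Chosen so that [e^(c y) = wp z / r]; since [wp z * wm z = r * r], also [e^(-c y) = wm z / r]. *)
exists (ln (wp z / r) / c) => x zx.
set y := _ / c.
have ey : expR (c * y) = wp z / r.
  by rewrite /y mulrCA divff ?mulr1 ?gt_eqF// lnK// posrE divr_gt0.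
have emy : expR ((- c) * y) = wm z / r.
  have wr : wp z / r != 0 by rewrite gt_eqF// divr_gt0.
  apply: (mulfI wr); rewrite -[in LHS]ey ex.
  have -> : wp z / r * (wm z / r) = (wp z * wm z) / (r * r) by field; rewrite gt_eqF.
  by rewrite pm divff// gt_eqF.
have -> : w x = (2 * c * w x) / (2 * c) by field; rewrite gt_eqF.
rewrite -sum wp_const// wm_const// /cosh2 -mulNr !mulrDr !expRD ey emy.
by field; rewrite !gt_eqF.
Qed.

Section Equation.
Variables (p lam z : R) (F d : R -> R).
Hypotheses (p2 : 2 < p) (F0 : forall x, z <= x -> 0 < F x)
  (dF : forall x, z <= x -> is_derive x 1 F (d x))
  (dd : forall x, z <= x -> is_derive x 1 d (lam * F x - F x `^ (p - 1)))
  (Fvanish : forall e, 0 < e -> exists X, forall x, X <= x -> z <= x -> F x <= e).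

(** Twice the conserved quantity [F'^2 / 2 - lam F^2 / 2 + F^p / p]. *)
Let energy x := d x * d x + (- lam) * (F x * F x) + 2 / p * F x `^ p.

Let energy_const x : z <= x -> energy x = energy z.
Proof.
move: x; apply: der_cst_on => x zx.
have e := derD (derD (derM (dd zx) (dd zx)) (derZ (- lam) (derM (dF zx) (dF zx))))
  (derZ (2 / p) (der_powR p (F0 zx) (dF zx))).
have p0 : p != 0 by rewrite gt_eqF//; have := p2; lra.
by apply: (der_eq e); field.
Qed.

(** Decay is known for [F] but not for [d]. On a distant unit interval the mean value theorem yields
    a point [c] where [d c] is an increment of [F], hence small; the constant [energy] is evaluated
    there. *)
Let energy_eq0 : energy z = 0.
Proof.
have p0 : 0 < p by have := p2; lra.
apply/eqP; rewrite -normr_le0; apply/ler_addgt0Pr => eps eps0; rewrite add0r.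
(* At [c] the three terms are bounded by [e^2], [|lam| e^2] and [e^2], and [e <= 1] turns the
   squares into [e]. *)
pose e := Num.min 1 (eps / (3 + `|lam|)).
have l3 : 0 < 3 + `|lam| by rewrite ltr_pwDl.
have e0 : 0 < e by rewrite lt_min ltr01 divr_gt0.
have e1 : e <= 1 by rewrite ge_min lexx.
have ee : e * (3 + `|lam|) <= eps by rewrite -ler_pdivlMr// ge_min lexx orbT.
have [X hX] := Fvanish e0.
pose x0 := Num.max X z.
have Xx0 : X <= x0 by rewrite le_max lexx.
have zx0 : z <= x0 by rewrite le_max lexx orbT.
have x01 : x0 < x0 + 1 by rewrite ltrDl.
have [| |c] := @MVT R F d _ _ x01.
- by move=> x; rewrite in_itv/= => /andP[/ltW x0x _]; apply: dF; exact: le_trans x0x.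
- apply: derivable_within_continuous => x; rewrite in_itv/= => /andP[x0x _].
  by have [] := dF (le_trans zx0 x0x).
rewrite in_itv/= => /andP[x0c _] e2.
have zc : z <= c by lra.
have Fc : F c <= e by apply: hX => //; lra.
have F1 := hX _ Xx0 zx0.
have F2 : F (x0 + 1) <= e by apply: hX; lra.
have G1 := F0 zx0; have G2 := F0 (_ : z <= x0 + 1); have Gc := F0 zc.
have {}G2 : 0 < F (x0 + 1) by apply: G2; lra.
have dc : `|d c| <= e.
  have -> : d c = F (x0 + 1) - F x0 by rewrite e2; ring.
  by rewrite ler_norml; lra.
rewrite -(energy_const zc) /energy.
have Fp : F c `^ p <= F c * F c.
  have -> : F c * F c = F c `^ 2%:R by rewrite powR_mulrn ?ltW// expr2.
  by apply: ger_powR; [rewrite Gc (le_trans Fc)|have := p2; lra].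
have dc2 : d c * d c <= e * e.
  by rewrite -expr2 -(real_normK (num_real (d c))) expr2 ler_pM.
have F22 : F c * F c <= e * e by rewrite ler_pM// ltW.
have Fp0 : 0 <= F c `^ p by exact: powR_ge0.
have p1 : 2 / p * F c `^ p <= F c `^ p.
  by rewrite ler_piMl// ler_pdivrMr//; have := p2; lra.
have p1' : 0 <= 2 / p * F c `^ p by rewrite mulr_ge0// divr_ge0// ltW.
apply: le_trans (ler_normD _ _) _; rewrite (ger0_norm p1').
apply: le_trans (lerD (ler_normD _ _) (lexx _)) _.
rewrite (ger0_norm (_ : 0 <= d c * d c)) -?expr2 ?sqr_ge0//.
rewrite normrM normrN (ger0_norm (_ : 0 <= F c ^+ 2)) ?sqr_ge0//.
have lF : `|lam| * F c ^+ 2 <= `|lam| * (e * e) by rewrite ler_wpM2l.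
rewrite !expr2.
have e2e : e * e <= e by rewrite ler_piMl// ltW.
have le2 : `|lam| * (e * e) <= `|lam| * e by rewrite ler_wpM2l.
by rewrite expr2 in lF; lra.
Qed.

Let dsqr x : z <= x -> d x * d x = lam * (F x * F x) - 2 / p * F x `^ p.
Proof. by move=> zx; have := energy_const zx; rewrite energy_eq0 /energy; lra. Qed.

(** With zero first integral, [lam F^2 = F'^2 + (2 / p) F^p > 0]. *)
Lemma frequency_gt0 : 0 < lam.
Proof.
have zz := lexx z; have Fz := F0 zz; have := dsqr zz.
have Fp : 0 < F z `^ p by exact: powR_gt0.
have p0 : 0 < p by have := p2; lra.
have p1 : 0 < 2 / p * F z `^ p by rewrite mulr_gt0// divr_gt0.
have s0 := sqr_ge0 (d z); rewrite expr2 in s0.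
rewrite ltNge => e; apply/negP => l0.
have FF : 0 < F z * F z by rewrite mulr_gt0.
have : lam * (F z * F z) <= 0 by rewrite mulr_le0_ge0// ltW.
lra.
Qed.

(* [w = F^(-(p-2)/2)] linearizes the equation: [w'' = c^2 w]. *)
Let k := (p - 2) / 2.
Let c := k * Num.sqrt lam.
Let w x := F x `^ (- k).
Let wd x := (- k) * (F x `^ (- k - 1) * d x).
Let k_gt0 : 0 < k.
Proof. by have := p2; rewrite /k; lra. Qed.
Let c_gt0 : 0 < c.
Proof. by have := k_gt0; have := frequency_gt0; rewrite -sqrtr_gt0 => l0 k0; rewrite mulr_gt0. Qed.
Let c_sqr : c * c = k * k * lam.
Proof.
have := sqr_sqrtr (ltW frequency_gt0); rewrite expr2 => e.
by rewrite /c mulrACA e.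
Qed.
Let p_k : p = 2 * k + 2.
Proof. by rewrite /k; field. Qed.

(** All powers are expressed through [F^(-k-2)], [F] and [F^(p-1)], which turns the later identities
    into rational ones. The last equation is the count of exponents for [p = 2 k + 2]. *)
Let powers x : z <= x ->
  [/\ F x `^ (- k - 1) = F x `^ (- k - 1 - 1) * F x,
      w x = F x `^ (- k - 1 - 1) * F x * F x,
      F x `^ p = F x * F x `^ (p - 1) &
      (F x `^ (- k - 1 - 1)) ^+ 2 * F x ^+ 3 * F x `^ (p - 1) = 1].
Proof.
move=> zx; have Fx := F0 zx; have Fn : F x != 0 by rewrite gt_eqF.
have aux r : F x `^ (r - 1) * F x = F x `^ r.
  by rewrite powRB ?Fn ?implybT// powRr1 ?ltW// divfK.
split; rewrite ?aux//; first by rewrite mulrC aux.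
rewrite -(powR_mulrn 3) ?ltW// expr2 -!powRD ?Fn ?implybT//.
by rewrite (_ : _ + _ = 0) ?powRr0// p_k; ring.
Qed.

Let dw x : z <= x -> is_derive x 1 w (wd x).
Proof.
move=> zx; apply: (der_eq (der_powR (- k) (F0 zx) (dF zx))).
by rewrite /wd mulrA.
Qed.

(** Inserting [F'^2] from the first integral into [k (k+1) F^(-k-2) F'^2 - k F^(-k-1) F''], the
    terms in [F^p] cancel because [2 (k + 1) = p]; what remains is [k^2 lam F^(-k)]. *)
Let dwd x : z <= x -> is_derive x 1 wd (c * c * w x).
Proof.
move=> zx; have [e1 e2 e3 _] := powers zx.
have e := derZ (- k) (derM (der_powR (- k - 1) (F0 zx) (dF zx)) (dd zx)).
apply: (der_eq e); rewrite c_sqr e2 e1.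
rewrite (_ : d x * _ = F x `^ (- k - 1 - 1) * (- k - 1) * (d x * d x)); last by ring.
rewrite dsqr// e3; set s := F x `^ (- k - 1 - 1); set q := F x `^ _.
have p0 : 2 * k + 2 != 0 by rewrite gt_eqF//; have := k_gt0; lra.
by rewrite p_k; field.
Qed.

Lemma profile_solution : exists y, forall x, z <= x -> F x = profile p lam (x + y).
Proof.
have zz := lexx z; have k0 := k_gt0; have c0 := c_gt0; have l0 := frequency_gt0.
have p0 : 0 < p by have := p2; lra.
(* The first integral of [w] is [k^2 (2 / p) F^(-2k-2) F^p = k^2 (2 / p)], whence this [r]. *)
pose r := k * Num.sqrt (2 / p).
have r0 : 0 < r by rewrite mulr_gt0// sqrtr_gt0 divr_gt0.
have rr : c * c * (w z * w z) - wd z * wd z = r * r.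
  have [e1 e2 e3 e4] := powers zz.
  rewrite c_sqr e2 /wd e1.
  move: (dsqr zz) e4; rewrite e3.
  set s := F z `^ (- k - 1 - 1); set q := F z `^ (p - 1) => dz e4.
  rewrite (_ : - k * (s * F z * d z) * (- k * (s * F z * d z)) =
    k * k * s ^+ 2 * F z ^+ 2 * (d z * d z)); last by ring.
  have -> : r * r = k * k * (2 / p).
    by rewrite /r mulrACA -(expr2 (Num.sqrt _)) sqr_sqrtr// divr_ge0// ltW.
  by rewrite dz -[RHS]mulr1 -e4; ring.
have w0 x : z <= x -> 0 < w x by move=> zx; exact: powR_gt0 (F0 zx).
have [y wy] := cosh_solution c0 r0 dw dwd w0 rr.
exists y => x zx.
have -> : F x = w x `^ (- k^-1).
  rewrite /w -powRrM (_ : - k * - k^-1 = 1) ?powRr1// ?ltW ?F0//.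
  by rewrite mulrNN divff// gt_eqF.
rewrite wy// /profile -/k -/c; congr ((_ * _) `^ _).
rewrite /r /c.
have -> : 2 / (p * lam) = 2 / p / lam by field; rewrite !gt_eqF.
have sl : 0 < Num.sqrt lam by rewrite sqrtr_gt0.
have kn : k != 0 by rewrite gt_eqF.
rewrite [in RHS]sqrtrM ?divr_ge0 ?ltW// sqrtrV ?ltW//.
move: (Num.sqrt lam) (Num.sqrt (2 / p)) k sl kn => sl s2 k' sl0 kn.
by field; rewrite kn gt_eqF.
Qed.

End Equation.
End Profile.

(** * Piecewise linear test functions *)

Section Tents.
Variable R : realType.
Local Notation leb := (@lebesgue_measure R).
Implicit Types (D : set R) (f g h : R -> R) (a b c x y z p lam : R).

Definition clamp a b x := Num.min (Num.max x a) b.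

Lemma clamp_lo a b x : a <= b -> x <= a -> clamp a b x = a.
Proof. by move=> ab xa; rewrite /clamp max_r// min_l. Qed.

Lemma clamp_mid a b x : a <= x -> x <= b -> clamp a b x = x.
Proof. by move=> ax xb; rewrite /clamp max_l// min_l. Qed.

Lemma clamp_hi a b x : a <= b -> b <= x -> clamp a b x = b.
Proof. by move=> ab bx; rewrite /clamp max_l ?min_r// (le_trans ab). Qed.

Lemma measurable_clamp D a b : measurable D -> measurable_fun D (clamp a b).
Proof.
move=> mD; apply: measurable_minr; last exact: measurable_cst.
by apply: measurable_maxr; [exact: measurable_id|exact: measurable_cst].
Qed.

(** The integral is the length of [[a, b]] intersected with [[x, y]]. It makes a tent, a combination
    of two clamps, the primitive of the step function [dtent]. *)
Lemma clamp_integral a b x y : a <= b -> x <= y ->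
  clamp a b y - clamp a b x = \int[leb]_(t in `[x, y]) \1_(`[a, b]%classic : set R) t.
Proof.
move=> ab xy; rewrite /Rintegral integral_indic//=.
have -> : `[a, b]%classic `&` `[x, y]%classic = `[Num.max a x, Num.min b y]%classic :> set R.
  apply/seteqP; split => t /=; rewrite !in_itv/= ge_max le_min.
    by move=> [/andP[-> ->] /andP[-> ->]].
  by move=> /andP[/andP[-> ->] /andP[-> ->]].
rewrite lebesgue_measure_itv/= lte_fin.
have [ya|/ltW ay] := leP y a.
  rewrite !clamp_lo// ?(le_trans xy)// subrr.
  by rewrite ltNge ge_min !le_max ya !orbT.
have [bx|/ltW xb] := leP b x.
  rewrite !clamp_hi// ?(le_trans bx)// subrr.
  by rewrite ltNge ge_min !le_max bx !orbT.
have -> : Num.max a x = clamp a b x.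
  by have [ax|xa] := leP a x; [rewrite clamp_mid|rewrite clamp_lo// ltW].
have -> : Num.min b y = clamp a b y.
  by have [byy|yb] := leP b y; [rewrite clamp_hi|rewrite clamp_mid// ltW].
case: ltP => [_|]; first by rewrite -EFinB.
suff : clamp a b x <= clamp a b y by move=> h1 h2; rewrite (@le_anti _ _ (clamp a b x) (clamp a b y)) ?subrr// h1.
have [ax|/ltW xa] := leP a x; last first.
  rewrite (clamp_lo ab xa); have [yb|/ltW byy] := leP y b; first by rewrite clamp_mid.
  by rewrite clamp_hi.
rewrite (clamp_mid ax xb); have [yb|/ltW byy] := leP y b; first by rewrite clamp_mid.
by rewrite clamp_hi.
Qed.

(* Piecewise linear, with nodes [a], [b], [c] and height [1] at [b]. *)
Definition tent a b c x :=
  (b - a)^-1 * (clamp a b x - a) - (c - b)^-1 * (clamp b c x - b).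

Definition dtent a b c x : R :=
  (b - a)^-1 * \1_(`[a, b]%classic : set R) x - (c - b)^-1 * \1_(`[b, c]%classic : set R) x.

Section TentFacts.
Variables a b c : R.
Hypotheses (ab : a < b) (bc : b < c).
Let ba0 : b - a != 0. Proof. by rewrite subr_eq0 gt_eqF. Qed.
Let cb0 : c - b != 0. Proof. by rewrite subr_eq0 gt_eqF. Qed.

Lemma tent_out x : ~ (a <= x <= c) -> tent a b c x = 0.
Proof.
move=> /negP; rewrite negb_and -!ltNge /tent => /orP[/ltW xa|/ltW cx].
  by rewrite !clamp_lo ?(ltW ab) ?(ltW bc)// ?(le_trans xa (ltW ab))// !subrr !mulr0 subrr.
rewrite !clamp_hi ?(ltW ab) ?(ltW bc)// ?(le_trans (ltW bc) cx)//.
by rewrite !mulVf// subrr.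
Qed.

Lemma tent_l x : a <= x -> x <= b -> tent a b c x = (x - a) / (b - a).
Proof.
move=> ax xb; rewrite /tent clamp_mid// clamp_lo ?(ltW bc)//.
by rewrite subrr mulr0 subr0 mulrC.
Qed.

Lemma tent_r x : b <= x -> x <= c -> tent a b c x = (c - x) / (c - b).
Proof.
move=> bx xc; rewrite /tent (clamp_hi (ltW ab))// clamp_mid// mulVf//.
by field.
Qed.

Lemma tent_bound x : 0 <= tent a b c x <= 1.
Proof.
have [/andP[ax xc]|/negP h] := boolP (a <= x <= c); last by rewrite tent_out// lexx ler01.
have b0 : 0 < b - a by rewrite subr_gt0.
have c0 : 0 < c - b by rewrite subr_gt0.
have [xb|/ltW bx] := leP x b.
  rewrite tent_l// divr_ge0 ?(ltW b0) ?subr_ge0//= ler_pdivrMr//; lra.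
rewrite tent_r// divr_ge0 ?(ltW c0) ?subr_ge0//= ler_pdivrMr//; lra.
Qed.

Lemma rint_indic D (s t : R) : measurable D -> rint D (\1_(`[s, t]%classic : set R)).
Proof.
move=> mD; apply: rint_sub (integrable_indic_itv s t true false) => //.
Qed.

Lemma measurable_tent D : measurable D -> measurable_fun D (tent a b c).
Proof.
by move=> mD; apply: measurable_funB; apply: measurable_funM => //;
  apply: measurable_funB => //; exact: measurable_clamp.
Qed.

Lemma tent_le_indic x : `|tent a b c x| <= \1_(`[a, c]%classic : set R) x.
Proof.
have /andP[t0 t1] := tent_bound x; rewrite ger0_norm// indicE.
case: (boolP (_ \in _)) => [//|/negP]; rewrite inE/= in_itv/= => h.
by rewrite tent_out.
Qed.

Lemma rint_tent D : measurable D -> rint D (tent a b c).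
Proof.
move=> mD; apply: (rint_le mD (measurable_tent mD) (rint_indic a c mD)) => x _.
exact: tent_le_indic.
Qed.

Lemma sqint_tent D : measurable D -> sqint D (tent a b c).
Proof.
move=> mD; split; first exact: measurable_tent.
apply: (rint_le mD _ (rint_indic a c mD)); first by apply: measurable_funX; exact: measurable_tent.
move=> x _; rewrite normrX; apply: le_trans (tent_le_indic x).
have /andP[t0 t1] := tent_bound x; rewrite ger0_norm// expr2 ler_piMl//.
Qed.

Lemma sqint_indic D (s t : R) : measurable D -> sqint D (\1_(`[s, t]%classic : set R)).
Proof.
move=> mD; split; first exact: rint_measurable (rint_indic s t mD).
apply: rint_eq (rint_indic s t mD) => // x _; rewrite indicE.
by case: (_ \in _); rewrite ?expr1n ?expr0n.
Qed.

Lemma H1on_tent D : measurable D -> is_interval D -> H1on D (tent a b c) (dtent a b c).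
Proof.
move=> mD iD; split; first exact: sqint_tent.
  have := sqintD mD (sqintZ (b - a)^-1 mD (sqint_indic a b mD))
    (sqintZ (- (c - b)^-1) mD (sqint_indic b c mD)).
  congr sqint; apply/funext => x; by rewrite /dtent mulNr.
move=> x y Dx Dy xy; rewrite /dtent RintegralB//; try by apply: rintZ => //; exact: rint_indic.
rewrite !RintegralZl//; try exact: rint_indic.
rewrite -!clamp_integral ?(ltW ab) ?(ltW bc)//.
by rewrite /tent; ring.
Qed.

Lemma Rint_mul_indic D f (s t : R) : measurable D -> `[s, t] `<=` D ->
  \int[leb]_(x in D) (f x * \1_(`[s, t]%classic : set R) x) = \int[leb]_(x in `[s, t]) f x.
Proof.
move=> mD sD; rewrite -[in RHS](setIidr sD) Rintegral_mkcondr.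
apply: Rint_eq => x _; rewrite patchE indicE.
by case: ifP; rewrite ?mulr1 ?mulr0.
Qed.

(** On each piece [dtent] is constant, so the primitive formula for [f] evaluates the pairing
    without any regularity of [g]. *)
Lemma Rint_mul_dtent D f g : measurable D -> is_interval D -> H1on D f g ->
  D a -> D c ->
  \int[leb]_(x in D) (g x * dtent a b c x) = slope f a b - slope f b c.
Proof.
move=> mD iD [sf sg fg] Da Dc.
have Db : D b by apply: (iD a c) => //; rewrite (ltW ab) (ltW bc).
have sab := is_interval_cc iD Da Db; have sbc := is_interval_cc iD Db Dc.
have i1 := sqint_mul mD sg (sqint_indic a b mD).
have i2 := sqint_mul mD sg (sqint_indic b c mD).
have -> : \int[leb]_(x in D) (g x * dtent a b c x) =
  \int[leb]_(x in D) ((b - a)^-1 * (g x * \1_(`[a, b]%classic : set R) x) -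
     (c - b)^-1 * (g x * \1_(`[b, c]%classic : set R) x)).
  by apply: Rint_eq => x _; rewrite /dtent; ring.
rewrite RintegralB//; [|exact: rintZ..].
rewrite !RintegralZl// !Rint_mul_indic// -!fg// ?(ltW ab) ?(ltW bc)//.
by rewrite /slope mulrC [in X in _ - X]mulrC.
Qed.

Lemma Rint_mul_tent D h : measurable D -> is_interval D -> D a -> D c ->
  rint D (fun x => h x * tent a b c x) ->
  \int[leb]_(x in D) (h x * tent a b c x) = tentint h a b c.
Proof.
move=> mD iD Da Dc ih.
have sac := is_interval_cc iD Da Dc.
have -> : \int[leb]_(x in D) (h x * tent a b c x) =
  \int[leb]_(x in `[a, c]) (h x * tent a b c x).
  rewrite -(Rint_mul_indic _ mD sac); apply: Rint_eq => x _; rewrite indicE.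
  case: (boolP (_ \in _)) => [_|/negP]; first by rewrite mulr1.
  by rewrite inE/= in_itv/= => /tent_out ->; rewrite !mulr0.
rewrite (@Rint_setU _ _ b) ?(ltW ab) ?(ltW bc)//; last first.
  exact: rint_sub ih.
rewrite /tentint; congr (_ + _); apply: Rint_eq => x /=; rewrite in_itv/= => /andP[h1 h2].
  by rewrite tent_l.
by rewrite tent_r.
Qed.
End TentFacts.

Lemma linear_coef_eq0 (c1 c2 c3 d : R) : 0 < d ->
  (forall e, `|e| < d -> 0 <= c1 * e + c2 * e ^+ 2 + c3 * e ^+ 3) -> c1 = 0.
Proof.
move=> d0 H; apply/eqP; apply: contrapT => /negP c10.
have n0 : 0 < `|c1| by rewrite normr_gt0.
pose K := `|c2| + `|c3| + 1.
have K0 : 0 < K by rewrite ltr_wpDl// addr_ge0.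
(* The third bound makes the quadratic and cubic terms together smaller than half of [|c1| * t]; the
   sign of [e] then makes the linear term [- |c1| * t]. *)
pose t := Num.min (d / 2) (Num.min 1 (`|c1| / (2 * K))).
have t0 : 0 < t by rewrite !lt_min ltr01 !divr_gt0// mulr_gt0.
have td : t < d.
  by apply: (@le_lt_trans _ _ (d / 2)); [rewrite /t ge_min lexx|lra].
have t1 : t <= 1 by rewrite /t !ge_min lexx orbT.
have tK : t * (2 * K) <= `|c1| by rewrite -ler_pdivlMr ?mulr_gt0// /t !ge_min lexx !orbT.
have ab2 : - `|c2| <= c2 <= `|c2| by rewrite -ler_norml.
have ab3 : - `|c3| <= c3 <= `|c3| by rewrite -ler_norml.
pose e := - (Num.sg c1) * t.
have e2 : e ^+ 2 = t ^+ 2 by rewrite /e exprMn sqrrN sqr_sg c10 mul1r.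
have e1 : c1 * e = - (`|c1| * t).
  by rewrite /e mulNr mulrN mulrA [c1 * _]mulrC -normrEsg.
have ne : `|e| = t by rewrite -sqrtr_sqr e2 sqrtr_sqr gtr0_norm.
have := H e; rewrite ne => /(_ td).
rewrite (exprS e 2) e2 e1.
have h2 : c2 * t ^+ 2 <= `|c2| * t ^+ 2 by apply: ler_wpM2r; [exact: sqr_ge0|exact: ler_norm].
have h3 : c3 * (e * t ^+ 2) <= `|c3| * t ^+ 2.
  apply: le_trans (ler_norm _) _; rewrite normrM ler_wpM2l// normrM ne.
  by rewrite (ger0_norm (sqr_ge0 _)) ler_piMl// sqr_ge0.
have h4 : t * (t * (2 * K)) <= t * `|c1| by rewrite ler_pM2l.
have h5 : 0 < t ^+ 2 by rewrite exprn_gt0.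
have h6 : 0 < `|c1| * t by rewrite mulr_gt0.
have h7 : t * (t * (2 * K)) = 2 * (`|c2| * t ^+ 2 + `|c3| * t ^+ 2 + t ^+ 2) by rewrite /K; ring.
lra.
Qed.

(* Competitors of mass [mu0] are obtained by rescaling by [k]; since
   [k^p >= 1 + (p/2)(k^2 - 1)], minimality becomes polynomial in [e] after
   multiplication by the mass. *)
Lemma first_variation_arith p (mu0 A B a1 a2 m1 m2 b1 : R) : 2 < p -> 0 < mu0 -> 0 < B ->
  (forall e k, 0 < k -> k ^+ 2 * (mu0 + 2 * e * m1 + e ^+ 2 * m2) = mu0 ->
    A / 2 - B / p <= k ^+ 2 / 2 * (A + 2 * e * a1 + e ^+ 2 * a2)
                     - k `^ p / p * (B + p * e * b1)) ->
  a1 = b1 - (B - A) / mu0 * m1.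
Proof.
move=> p2 mu0_gt0 B0 H.
have p0 : 0 < p by lra.
(* For [|e| < d1] the perturbed mass [N] stays positive, and for [|e| < d2] so does
   [B + p * e * b1], by which the Bernoulli bound is multiplied; [|e| < 1] controls [e ^+ 2] by
   [|e|]. *)
pose d1 := mu0 / (2 * `|m1| + `|m2| + 1); pose d2 := B / (p * `|b1| + 1).
have D1 : 0 < 2 * `|m1| + `|m2| + 1 by rewrite ltr_wpDl// addr_ge0// mulr_ge0.
have D2 : 0 < p * `|b1| + 1 by rewrite ltr_wpDl// mulr_ge0// ltW.
pose d := Num.min 1 (Num.min d1 d2).
have d0 : 0 < d by rewrite !lt_min ltr01 !divr_gt0.
have := @linear_coef_eq0 (mu0 * a1 - m1 * A + m1 * B - mu0 * b1)
  (mu0 * a2 / 2 - m2 * A / 2 - 2 * b1 * m1 + m2 * B / 2 + p * m1 * b1)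
  (- b1 * m2 + p * m2 * b1 / 2) d d0.
suff aux e : `|e| < d -> 0 <= (mu0 * a1 - m1 * A + m1 * B - mu0 * b1) * e +
    (mu0 * a2 / 2 - m2 * A / 2 - 2 * b1 * m1 + m2 * B / 2 + p * m1 * b1) * e ^+ 2 +
    (- b1 * m2 + p * m2 * b1 / 2) * e ^+ 3.
  move=> /(_ aux) h.
  have : mu0 * a1 = mu0 * (b1 - (B - A) / mu0 * m1).
    rewrite (_ : mu0 * (b1 - (B - A) / mu0 * m1) = mu0 * b1 - (B - A) * m1); first by lra.
    by field; rewrite gt_eqF.
  by apply: mulfI; rewrite gt_eqF.
rewrite !lt_min => /and3P[e1 ed1 ed2].
pose N := mu0 + 2 * e * m1 + e ^+ 2 * m2.
have N0 : 0 < N.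
  have h1 : - (e * m1) <= `|e| * `|m1| by rewrite -normrM -normrN ler_norm.
  have h2 : - (e ^+ 2 * m2) <= `|e| * `|m2|.
    apply: le_trans (ler_norm _) _; rewrite normrN normrM ler_wpM2r// normrX expr2.
    by rewrite ler_piMl// ltW.
  have h3 : `|e| * (2 * `|m1| + `|m2| + 1) < mu0 by rewrite -ltr_pdivlMr.
  have h4 : 0 <= `|e| by [].
  rewrite /N; lra.
have Be : 0 < B + p * e * b1.
  have h1 : - (e * b1) <= `|e| * `|b1| by rewrite -normrM -normrN ler_norm.
  have h3 : `|e| * (p * `|b1| + 1) < B by rewrite -ltr_pdivlMr.
  have h4 : 0 <= `|e| by [].
  have h5 : p * (- (e * b1)) <= p * (`|e| * `|b1|) by rewrite ler_pM2l.
  lra.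
pose s := mu0 / N; pose k := Num.sqrt s.
have s0 : 0 < s by rewrite divr_gt0.
have k0 : 0 < k by rewrite sqrtr_gt0.
have ks : k ^+ 2 = s by rewrite sqr_sqrtr// ltW.
have sN : s * N = mu0 by rewrite divfK// gt_eqF.
have := H e k k0; rewrite ks => /(_ sN) ineq.
have kp : 1 + p / 2 * (s - 1) <= k `^ p.
  have -> : k `^ p = s `^ (p / 2).
    by rewrite -ks -(powR_mulrn 2 (ltW k0)) -powRrM; congr (_ `^ _); field.
  exact: (@powR_bernoulli R (p / 2) s ltac:(lra) (ltW s0)).
have : (1 + p / 2 * (s - 1)) / p * (B + p * e * b1) <= k `^ p / p * (B + p * e * b1).
  by rewrite ler_pM2r// ler_pM2r// invr_gt0.
move=> ineq2.
have : 0 <= N * (s / 2 * (A + 2 * e * a1 + e ^+ 2 * a2)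
   - (1 + p / 2 * (s - 1)) / p * (B + p * e * b1) - (A / 2 - B / p)).
  rewrite mulr_ge0 ?(ltW N0)//; lra.
congr (0 <= _).
rewrite (_ : N * _ = (s * N) * ((A + 2 * e * a1 + e ^+ 2 * a2) / 2 - (B + p * e * b1) / 2)
   - N * ((1 - p / 2) / p * (B + p * e * b1) + A / 2 - B / p)); last by field; rewrite gt_eqF.
by rewrite sN /N; field; rewrite gt_eqF.
Qed.

End Tents.

(** * The Euler-Lagrange equation *)

Section EulerLagrange.
Variable R : realType.
Local Notation leb := (@lebesgue_measure R).
Implicit Types (D : set R) (f g h : R -> R) (a b c x y z p lam : R).

(** Applied to a function this is its mass, to a weak derivative twice its kinetic energy. *)
Definition rmass D f := \int[leb]_(x in D) f x ^+ 2.
Definition rpow p D f := \int[leb]_(x in D) abspow p (f x).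

Lemma rmassZ D k f : measurable D -> sqint D f ->
  rmass D (fun x => k * f x) = k ^+ 2 * rmass D f.
Proof.
move=> mD sf; rewrite /rmass -RintegralZl//; last exact: sf.2.
by apply: Rint_eq => x _; rewrite exprMn.
Qed.

Lemma rpowZ p D k f : measurable D -> rint D (fun x => abspow p (f x)) ->
  rpow p D (fun x => k * f x) = abspow p k * rpow p D f.
Proof.
move=> mD pf; rewrite /rpow -RintegralZl//.
by apply: Rint_eq => x _; rewrite abspowM.
Qed.

Lemma rmass_ge0 D f : 0 <= rmass D f.
Proof. exact: Rint_sqr_ge0. Qed.

Lemma rpow_ge0 p D f : 0 <= rpow p D f.
Proof. by apply: Rintegral_ge0 => x _; exact: abspow_ge0. Qed.

(** A zero integral would make [f] vanish almost everywhere, so that [[a, b]], where [f > 0], would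
    lie in a null set. *)
Lemma Rint_gt0 D (a b : R) f : measurable D -> `[a, b] `<=` D -> a < b ->
  rint D f -> (forall x, D x -> 0 <= f x) -> (forall x, a <= x <= b -> 0 < f x) ->
  0 < \int[leb]_(x in D) f x.
Proof.
move=> mD sD ab fi f0 fp.
have fi' := rint_sub (measurable_itv _) mD sD fi.
apply: lt_le_trans (Rint_sub_ge0 (measurable_itv _) mD sD fi f0).
rewrite lt_neqAle Rintegral_ge0 ?andbT; last by move=> x /sD; exact: f0.
apply/eqP => int0.
have : (\int[leb]_(x in `[a, b]) `|(f x)%:E| = 0)%E.
  transitivity (\int[leb]_(x in `[a, b]) (f x)%:E)%E; last by rewrite rint_EFin// -int0.
  by apply: eq_integral => x /set_mem /sD Dx; rewrite /= ger0_norm// f0.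
move=> /(ae_eq_integral_abs leb (measurable_itv _) (measurable_int leb fi')).
move=> [N [mN N0 abN]].
have : (leb `[a, b]%classic <= leb N)%E.
  apply: le_measure; rewrite ?inE//.
  move=> x xab; apply: abN => /= /(_ xab) /eqP; rewrite eqe => /eqP fx.
  by move: xab; rewrite /= in_itv/= => /fp; rewrite fx ltxx.
rewrite [leb N]N0 lebesgue_measure_itv/= lte_fin ab.
by rewrite -EFinB lee_fin; lra.
Qed.

(* Everything outside [D] enters only through the totals [mu0], [A0], [B0]. *)
Lemma euler_lagrange D p f g (mu0 A0 B0 : R) :
  measurable D -> is_interval D -> 2 < p -> H1on D f g -> bounded_on D f ->
  (forall x, D x -> 0 < f x) -> 0 < mu0 -> 0 < B0 ->
  (forall a b c e k, a < b -> b < c -> D a -> D c -> 0 < k ->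
     let f' := fun x => f x + e * tent a b c x in
     let g' := fun x => g x + e * dtent a b c x in
     k ^+ 2 * (mu0 + (rmass D f' - rmass D f)) = mu0 ->
     A0 / 2 - B0 / p <= k ^+ 2 / 2 * (A0 + (rmass D g' - rmass D g))
       - k `^ p / p * (B0 + (rpow p D f' - rpow p D f))) ->
  forall a b c, a < b -> b < c -> D a -> D c ->
    slope f a b - slope f b c =
    tentint (fun x => f x `^ (p - 1) - (B0 - A0) / mu0 * f x) a b c.
Proof.
move=> mD iD p2 fg [K fK] f0 mu0_gt0 B0_gt0 H a b c ab bc Da Dc.
have [sf sg _] := fg.
have [st sdt _] := H1on_tent ab bc mD iD.
have mfp : measurable_fun D (fun x => f x `^ (p - 1)).
  by apply: (measurableT_comp (f := fun y : R => y `^ (p - 1))) => //; exact: sf.1.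
have ift := sqint_mul mD sf st.
have ifpt : rint D (fun x => f x `^ (p - 1) * tent a b c x).
  apply: (rint_le mD _ (rintZ (K `^ (p - 1)) mD (rint_tent ab bc mD))).
    by apply: measurable_funM => //; exact: measurable_tent.
  move=> x Dx; have /andP[t0 _] := tent_bound ab bc x.
  rewrite ger0_norm ?mulr_ge0 ?powR_ge0// ler_wpM2r//.
  have fx := f0 _ Dx; have := fK _ Dx; rewrite gtr0_norm// => fxK.
  have h := @ge0_ler_powR R (p - 1) ltac:(lra).
  by apply: h => //; rewrite nnegrE ?ltW// (lt_le_trans fx).
have ifp : rint D (fun x => abspow p (f x)) by apply: rint_abspow => //; exists K.
set lam := (B0 - A0) / mu0.
pose a1 := \int[leb]_(x in D) (g x * dtent a b c x).
pose m1 := \int[leb]_(x in D) (f x * tent a b c x).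
pose b1 := \int[leb]_(x in D) (f x `^ (p - 1) * tent a b c x).
have : a1 = b1 - lam * m1.
  apply: (@first_variation_arith R p mu0 A0 B0 a1 (rmass D (dtent a b c)) m1
    (rmass D (tent a b c)) b1) => // e k k0.
  have := H a b c e k ab bc Da Dc k0; cbv zeta.
  have -> : rmass D (fun x => f x + e * tent a b c x) - rmass D f =
      2 * e * m1 + e ^+ 2 * rmass D (tent a b c).
    by rewrite /rmass Rint_sqrD//; rewrite -/m1; lra.
  have -> : rmass D (fun x => g x + e * dtent a b c x) - rmass D g =
      2 * e * a1 + e ^+ 2 * rmass D (dtent a b c).
    by rewrite /rmass Rint_sqrD//; rewrite -/a1; lra.
  move=> /= H' km; have {}km : k ^+ 2 * (mu0 + (2 * e * m1 + e ^+ 2 * rmass D (tent a b c))) = mu0.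
    by rewrite -[RHS]km; ring.
  apply: le_trans (H' km) _; rewrite !addrA lerD2l lerN2.
  rewrite ler_wpM2l ?divr_ge0 ?powR_ge0//; first lra.
  rewrite -addrA lerD2l lerBrDl.
  (* Only a lower bound on the power term of the competitor is wanted, so the pointwise tangent
     inequality at [f x] is integrated. *)
  have -> : rpow p D f + p * e * b1 =
      \int[leb]_(x in D) (abspow p (f x) + p * e * (f x `^ (p - 1) * tent a b c x)).
    by rewrite RintegralD//; [rewrite RintegralZl|exact: rintZ].
  apply: le_Rintegral => //; first by apply: rintD => //; exact: rintZ.
    apply: rint_abspow => //; first by apply: sqintD => //; exact: sqintZ.
    exists (K + `|e|) => x Dx; apply: le_trans (ler_normD _ _) _.
    rewrite lerD ?fK// normrM ler_piMr//.
    by have /andP[t0 t1] := tent_bound ab bc x; rewrite ger0_norm.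
  move=> x Dx; have fx := f0 _ Dx.
  have p1 : 1 < p by lra.
  have := abspow_tangent (f x + e * tent a b c x) p1 fx.
  by rewrite {2}/abspow gtr0_norm//; lra.
rewrite /a1 (Rint_mul_dtent ab bc mD iD fg Da Dc) => ->.
have ih : rint D (fun x => (f x `^ (p - 1) - lam * f x) * tent a b c x).
  by apply: rint_eq (rintD mD ifpt (rintZ (- lam) mD ift)) => // x _; ring.
rewrite -(Rint_mul_tent ab bc mD iD Da Dc ih) /b1 /m1.
rewrite -RintegralZl// -RintegralB//; last exact: rintZ.
by apply: Rint_eq => x _; ring.
Qed.

(** Freezing [f] to the left of [z] yields a function continuous on the whole line, as
    [weak_solution_regular] asks of its right-hand side. *)
Lemma H1on_continuous_max D f g z : measurable D -> is_interval D -> H1on D f g ->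
  (forall x, z <= x -> D x) -> continuous (fun x => f (Num.max x z)).
Proof.
move=> mD iD fg zD x; apply/cvgrPdist_le => e e0.
set I := \int[leb]_(t in D) g t ^+ 2.
have I0 : 0 <= I by exact: Rint_sqr_ge0.
pose d := e / (1 + I).
have d0 : 0 < d by rewrite divr_gt0//; lra.
have dI : d + d * I = e.
  rewrite (_ : d + d * I = d * (1 + I)); last by ring.
  by rewrite /d divfK// gt_eqF//; lra.
have modz s t : s <= t -> t - s <= d * d -> `|f (Num.max t z) - f (Num.max s z)| <= e.
  move=> st ts.
  have st' : Num.max s z <= Num.max t z by rewrite ge_max !le_max st lexx !orbT.
  have ts' : Num.max t z - Num.max s z <= t - s.
    by have [tz|zt] := leP t z; have [sz|zs] := leP s z; lra.
  have Dm u : D (Num.max u z) by apply: zD; rewrite le_max lexx orbT.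
  apply: le_trans (H1on_modulus mD iD fg (Dm _) (Dm _) st' d0) _.
  rewrite -/I -[leRHS]dI lerD2r ler_pdivrMr//; lra.
near=> y.
have xy : `|x - y| <= d * d.
  by near: y; apply: cvgr_dist_le; [exact: cvg_id|rewrite mulr_gt0].
have [le_xy|/ltW le_yx] := leP x y.
  by rewrite distrC modz//; move: xy; rewrite distrC ger0_norm ?subr_ge0.
by rewrite modz//; move: xy; rewrite ger0_norm ?subr_ge0.
Unshelve. all: by end_near. Qed.

Lemma profile_of_weak_solution D p lam z f g : measurable D -> is_interval D ->
  H1on D f g -> (forall x, z <= x -> D x) -> 2 < p -> (forall x, D x -> 0 < f x) ->
  (forall e, 0 < e -> exists X, forall x, X <= x -> z <= x -> f x <= e) ->
  (forall a b c, a < b -> b < c -> D a -> D c -> slope f a b - slope f b c =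
     tentint (fun x => f x `^ (p - 1) - lam * f x) a b c) ->
  0 < lam /\ exists y, forall x, z <= x -> f x = profile p lam (x + y).
Proof.
move=> mD iD fg zD p2 f0 fv eqf.
pose ft x := f (Num.max x z).
have ft0 x : 0 < ft x by apply/f0/zD; rewrite le_max lexx orbT.
have fte x : z <= x -> ft x = f x by move=> zx; rewrite /ft max_l.
have cft : continuous ft by exact: H1on_continuous_max fg zD.
have cG x : {for x, continuous (fun x => ft x `^ (p - 1) - lam * ft x)}.
  apply: cvgB; last by apply: cvgM; [exact: cvg_cst|exact: cft].
  have dp := is_derive1_powR (p - 1) (ft0 x).
  have cp : {for ft x, continuous (@powR R ^~ (p - 1))}.
    by apply/differentiable_continuous/derivable1_diffP; case: dp.
  exact: (@cvg_comp _ _ _ ft (@powR R ^~ (p - 1)) _ _ _ (cft x) cp).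
have [|F [d [Ff dF dd]]] := @weak_solution_regular R ft _ z cG.
  move=> a b c za ab bc; rewrite /slope !fte//; try lra.
  rewrite -/(slope f a b) -/(slope f b c) eqf//; try by apply: zD; lra.
  by rewrite /tentint; congr (_ + _); apply: Rint_eq => x; rewrite /= in_itv/= => /andP[h1 h2];
    rewrite fte//; lra.
have F0 x : z <= x -> 0 < F x by move=> zx; rewrite Ff.
have dd' x : z <= x -> is_derive x 1 d (lam * F x - F x `^ (p - 1)).
  by move=> zx; apply: (der_eq (dd _ zx)); rewrite Ff//; ring.
have Fv e : 0 < e -> exists X, forall x, X <= x -> z <= x -> F x <= e.
  by move=> /fv[X hX]; exists X => x Xx zx; rewrite Ff// fte// hX.
split; first exact: (frequency_gt0 p2 F0 dF dd' Fv).
have [y hy] := profile_solution p2 F0 dF dd' Fv.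
by exists y => x zx; rewrite -hy// Ff// fte.
Qed.

End EulerLagrange.

(** * Sliding along a line *)

Section Gluing.
Variable R : realType.
Local Notation leb := (@lebesgue_measure R).
Local Notation ci0 := (@set_ci0 R).
Implicit Types (D A B : set R) (f g h : R -> R) (a b c x y z p lam : R).

Definition leb_preserving (phi : R -> R) :=
  @measurable_fun _ _ (measurableTypeR R) (measurableTypeR R) setT phi /\
  forall A, measurable A -> leb (phi @^-1` A) = leb A.

(** The pushforward agrees with Lebesgue measure on half-open intervals, and these determine it. *)
Lemma leb_preserving_shift c : leb_preserving (fun x => c + x).
Proof.
have mc : @measurable_fun _ _ (measurableTypeR R) (measurableTypeR R) setT (fun x => c + x).
  suff : measurable_fun setT (fun x : R => c + x) by [].
  by apply: measurable_funD; [exact: measurable_cst|exact: measurable_id].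
pose mphi := isMeasurableFun.Build _ _ _ _ _ mc.
pose phi : {mfun measurableTypeR R >-> measurableTypeR R} := HB.pack (fun x => c + x) mphi.
split=> // A mA; apply/esym.
apply: (lebesgue_measure_unique (mu := pushforward leb phi)) => //= _ [[a b]] _ <-.
rewrite /pushforward (_ : _ @^-1` _ = `]a - c, b - c]%classic); last first.
  by apply/seteqP; split => x /=; rewrite !in_itv/= ltrBlDl lerBrDl.
rewrite /= !lebesgue_measure_itv/= !lte_fin.
by rewrite ltrD2r -!EFinB; congr (if _ then _%:E else _); ring.
Qed.

Lemma leb_preserving_reflect c : leb_preserving (fun x => c - x).
Proof.
have mc : @measurable_fun _ _ (measurableTypeR R) (measurableTypeR R) setT (fun x => c - x).
  suff : measurable_fun setT (fun x : R => c - x) by [].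
  by apply: measurable_funB; [exact: measurable_cst|exact: measurable_id].
split=> // A mA; have [ms s] := leb_preserving_shift c.
rewrite -(s _ mA) -(lebesgue_measureN (A := (fun x => c + x) @^-1` A))//.
by rewrite -[X in measurable X]setTI; exact: ms.
Qed.

Lemma rint_comp phi D h : leb_preserving phi -> measurable D -> rint D h ->
  rint (phi @^-1` D) (fun x => h (phi x)) /\
  \int[leb]_(x in phi @^-1` D) h (phi x) = \int[leb]_(x in D) h x.
Proof.
move=> [mphi pphi] mD ih.
have mphiD : measurable (phi @^-1` D) by rewrite -[X in measurable X]setTI; exact: mphi.
(* [h] is measurable only on [D]; its extension by zero is measurable everywhere and can be composed
   with [phi]. *)
pose h' := h \_ D.
have mh' : measurable_fun setT h'.
  by apply/(measurable_restrictT _ mD); exact: rint_measurable ih.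
have h'E x : D x -> h' x = h x by move=> Dx; rewrite /h' patchE mem_set.
pose psi : measurableTypeR R -> measurableTypeR R := phi.
have pushE (f : measurableTypeR R -> \bar R) :
    (\int[pushforward leb psi]_(x in D) f x = \int[leb]_(x in D) f x)%E.
  pose mix := isMeasurableFun.Build _ _ _ _ _ mphi.
  pose phiM : {mfun measurableTypeR R >-> measurableTypeR R} := HB.pack phi mix.
  refine (@eq_measure_integral _ _ _ _ leb (pushforward leb phiM) _ _) => A mA _.
  exact: pphi.
have ih' : leb.-integrable (phi @^-1` D) ((EFin \o h') \o phi).
  apply/integrableP; split.
    apply: measurable_funTS; apply: measurableT_comp => //; exact/measurable_EFinP.
  have /integrableP[_] := ih; rewrite -pushE ge0_integral_pushforward//; last first.
    by apply: measurableT_comp => //; apply/measurable_EFinP; exact: rint_measurable ih.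
  by congr (_ < _)%E; apply: eq_integral => x /set_mem Dx /=; rewrite h'E.
split; first by apply: rint_eq ih' => // x Dx /=; rewrite h'E.
rewrite /Rintegral; congr fine; rewrite -[RHS]pushE.
transitivity (\int[pushforward leb psi]_(x in D) (EFin \o h') x)%E; last first.
  by rewrite !pushE; apply: eq_integral => x /set_mem Dx /=; rewrite h'E.
rewrite integral_pushforward//; last exact/measurable_EFinP.
by apply: eq_integral => x /set_mem Dx /=; rewrite h'E.
Unshelve. exact: mphi.
Qed.

Lemma sqint_comp phi D f : leb_preserving phi -> measurable D -> sqint D f ->
  sqint (phi @^-1` D) (fun x => f (phi x)).
Proof.
move=> pphi mD [mf fi]; split; last exact: (rint_comp pphi mD fi).1.
by apply: (measurable_comp mD) => //; [move=> _ [x Dx <-]|exact: measurable_funTS pphi.1].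
Qed.

Lemma H1on_shift D f g c : measurable D -> is_interval D -> H1on D f g ->
  H1on ((fun x => c + x) @^-1` D) (fun x => f (c + x)) (fun x => g (c + x)).
Proof.
move=> mD iD [sf sg fg]; have P := leb_preserving_shift c.
split; [exact: (sqint_comp P)|exact: (sqint_comp P)|].
move=> x y Dx Dy xy; rewrite fg ?lerD2l//.
have sD := is_interval_cc iD Dx Dy.
rewrite -(rint_comp P (measurable_itv _) (sqint_rint (sqint_sub (measurable_itv _) mD sD sg))).2.
congr (Rintegral _ _ _); apply/seteqP.
by split => t /=; rewrite !in_itv/= !lerD2l.
Qed.

Lemma H1on_reflect D f g c : measurable D -> is_interval D -> H1on D f g ->
  H1on ((fun x => c - x) @^-1` D) (fun x => f (c - x)) (fun x => - 1 * g (c - x)).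
Proof.
move=> mD iD [sf sg fg]; have P := leb_preserving_reflect c.
have mD' : measurable ((fun x => c - x) @^-1` D).
  by rewrite -[X in measurable X]setTI; exact: P.1.
split; [exact: (sqint_comp P)|by apply: sqintZ => //; exact: (sqint_comp P)|].
move=> x y Dx Dy xy.
have sD := is_interval_cc iD Dy Dx.
have ig := sqint_rint (sqint_sub (measurable_itv _) mD sD sg).
have [i1 e1] := rint_comp P (measurable_itv _) ig.
have preE : (fun x => c - x) @^-1` `[c - y, c - x] = `[x, y]%classic.
  by apply/seteqP; split => t /=; rewrite !in_itv/=; lra.
rewrite preE in i1 e1.
rewrite RintegralZl// e1 -fg ?lerD2l ?lerN2//; ring.
Qed.

(** * Gluing two functions at a point of the half-line *)

Lemma Rint_pieces D A B f f1 f2 : measurable A -> measurable B -> D = A `|` B ->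
  (forall x, A x -> ~ B x) -> {in A, f =1 f1} -> {in B, f =1 f2} ->
  rint A f1 -> rint B f2 ->
  rint D f /\ \int[leb]_(x in D) f x = \int[leb]_(x in A) f1 x + \int[leb]_(x in B) f2 x.
Proof.
move=> mA mB -> AB fA fB i1 i2.
have eqf x : (f \_ (A `|` B)) x = (f1 \_ A) x + (f2 \_ B) x.
  rewrite !patchE; have [xA|xA] := boolP (x \in A).
    rewrite mem_set ?fA//; last by left; exact: set_mem.
    by rewrite memNset ?addr0//; apply: AB; exact: set_mem.
  have [xB|xB] := boolP (x \in B).
    by rewrite mem_set ?fB ?add0r//; right; exact: set_mem.
  rewrite memNset ?addr0// => -[] /mem_set; exact/negP.
have rT E h : measurable E -> rint E h <-> rint setT (h \_ E).
  move=> mE; rewrite /rint -[EFin \o (h \_ E)]restrict_EFin; exact: integrable_mkcond.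
have j1 := (rT _ _ mA).1 i1; have j2 := (rT _ _ mB).1 i2.
split; first by apply/rT; [exact: measurableU|apply: rint_eq (rintD _ j1 j2)].
rewrite !(Rintegral_mkcond leb _ f1) !(Rintegral_mkcond leb _ f2) Rintegral_mkcond.
by rewrite -RintegralD//; apply: Rint_eq => x _; exact: eqf.
Qed.

Definition glue c f1 f2 x : R := if x <= c then f1 x else f2 x.

Section Glue.
Variables (c : R) (c0 : 0 <= c).
Local Notation I := (`[0, c]%classic : set R).
Local Notation J := (`]c, +oo[%classic : set R).
Local Notation J' := (`[c, +oo[%classic : set R).

Lemma ci0_split : ci0 = I `|` J.
Proof.
apply/seteqP; split => x; rewrite /set_ci0 /= !in_itv/= !andbT.
  by move=> x0; have [xc|cx] := leP x c; [left; rewrite x0|right].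
by move=> [/andP[]//|/ltW]; exact: le_trans.
Qed.

Lemma glue_l f1 f2 : {in I, glue c f1 f2 =1 f1}.
Proof. by move=> x; rewrite inE/= in_itv/= /glue => /andP[_ ->]. Qed.

Lemma glue_r f1 f2 : {in J, glue c f1 f2 =1 f2}.
Proof. by move=> x; rewrite inE/= in_itv/= andbT /glue leNgt => ->. Qed.

Lemma Rint_glue f1 f2 : rint I f1 -> rint J' f2 ->
  rint ci0 (glue c f1 f2) /\ \int[leb]_(x in ci0) glue c f1 f2 x =
   \int[leb]_(x in I) f1 x + \int[leb]_(x in J') f2 x.
Proof.
move=> i1 i2; have i2' : rint J f2.
  by apply: rint_sub i2 => //; apply: subset_itv; rewrite bnd_simp.
rewrite -(Rintegral_itv_obnd_cbnd (b := +oo%O) i2').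
apply: Rint_pieces => //.
- exact: ci0_split.
- by move=> x /=; rewrite !in_itv/= andbT => /andP[_]; rewrite leNgt => /negP.
- exact: glue_l.
- exact: glue_r.
Qed.

Lemma sqint_glue f1 f2 : sqint I f1 -> sqint J' f2 -> sqint ci0 (glue c f1 f2).
Proof.
move=> [m1 i1] [m2 i2]; split.
  rewrite ci0_split; apply/measurable_funU => //; split.
    by apply: eq_measurable_fun m1 => x xI; rewrite glue_l.
  have m2' : measurable_fun J f2.
    by apply: measurable_funS m2 => //; apply: subset_itv; rewrite bnd_simp.
  by apply: eq_measurable_fun m2' => x xI; rewrite glue_r.
apply: rint_eq (Rint_glue i1 i2).1 => // [|x _]; first exact: measurable_itv.
by rewrite /glue; case: ifP.
Qed.

(** Equal values at [c] exclude a jump, so increments across [c] are sums of increments up to [c]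
    and from [c]. *)
Lemma H1on_glue f1 f2 g1 g2 : H1on I f1 g1 -> H1on J' f2 g2 -> f1 c = f2 c ->
  H1on ci0 (glue c f1 f2) (glue c g1 g2).
Proof.
move=> [s1 t1 e1] [s2 t2 e2] fc; split; [exact: sqint_glue|exact: sqint_glue|].
have tg := sqint_glue t1 t2.
have Ix x : 0 <= x -> x <= c -> I x by move=> x0 xc; rewrite /= in_itv/= x0.
have Jx x : c <= x -> J' x by move=> cx; rewrite /= in_itv/= cx.
have le_l x y : 0 <= x -> x <= y -> y <= c ->
    glue c f1 f2 y - glue c f1 f2 x = \int[leb]_(t in `[x, y]) glue c g1 g2 t.
  move=> x0 xy yc; rewrite /glue yc (le_trans xy yc) e1//; last 2 first.
  - by apply: Ix => //; exact: le_trans yc.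
  - by apply: Ix => //; exact: le_trans xy.
  apply: Rint_eq => t; rewrite /= in_itv/= => /andP[_ ty].
  by rewrite (le_trans ty yc).
have glue_ge x : c <= x -> glue c f1 f2 x = f2 x.
  move=> cx; rewrite /glue; have [xc|//] := leP x c.
  by have -> : x = c by [apply/le_anti; rewrite xc].
have le_r x y : c <= x -> x <= y ->
    glue c f1 f2 y - glue c f1 f2 x = \int[leb]_(t in `[x, y]) glue c g1 g2 t.
  move=> cx xy; have cy := le_trans cx xy; have x0 := le_trans c0 cx.
  rewrite !glue_ge// e2 ?Jx//; try exact: Jx.
  have ir : rint `[x, y] g2.
    apply: sqint_rint; apply: sqint_sub t2 => //.
    by move=> t; rewrite /= !in_itv/= andbT => /andP[xt _]; exact: le_trans xt.
  have ig : rint `[x, y] (glue c g1 g2).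
    apply: sqint_rint; apply: sqint_sub tg => //; first exact: measurable_itv.
    by move=> t; rewrite /set_ci0 /= !in_itv/= andbT => /andP[xt _]; exact: le_trans xt.
  have oS : `]x, y] `<=` `[x, y]%classic by apply: subset_itv; rewrite bnd_simp.
  rewrite -!Rintegral_itv_obnd_cbnd; [|by apply: rint_sub ig|by apply: rint_sub ir].
  apply: Rint_eq => t; rewrite /= in_itv/= => /andP[xt _].
  by rewrite /glue leNgt (le_lt_trans cx xt).
move=> x y; rewrite /set_ci0 /= !in_itv/= !andbT => x0 y0 xy.
have [yc|/ltW cy] := leP y c; first exact: le_l.
have [cx|/ltW xc] := leP c x; first exact: le_r.
have ig : rint `[x, y] (glue c g1 g2).
  apply: sqint_rint; apply: sqint_sub tg => //; first exact: measurable_itv.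
  by move=> t; rewrite /set_ci0 /= !in_itv/= andbT => /andP[xt _]; exact: le_trans xt.
by rewrite (Rint_setU xc cy ig) -le_l// -le_r//; ring.
Qed.
End Glue.

(* Two half-lines at a common vertex form a line; sliding the function along
   that line by [c] preserves all integrals of even quantities. *)
Lemma slide_two_half_lines p c f1 g1 f2 g2 : 2 < p -> 0 <= c ->
  H1on ci0 f1 g1 -> H1on ci0 f2 g2 -> f1 0 = f2 0 ->
  exists w1 d1 w2 d2, [/\ H1on ci0 w1 d1, H1on ci0 w2 d2,
    w1 0 = f1 c /\ w2 0 = f1 c &
    [/\ rmass ci0 w1 + rmass ci0 w2 = rmass ci0 f1 + rmass ci0 f2,
        rmass ci0 d1 + rmass ci0 d2 = rmass ci0 g1 + rmass ci0 g2 &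
        rpow p ci0 w1 + rpow p ci0 w2 = rpow p ci0 f1 + rpow p ci0 f2]].
Proof.
move=> p2 c0 fg1 fg2 f0.
have mC : measurable ci0 by exact: measurable_itv.
have iC : is_interval ci0 by exact: interval_is_interval.
have inC x : ci0 x = (0 <= x) :> Prop.
  by rewrite /set_ci0 /= in_itv/= andbT.
have b1 := H1on_bounded_shift mC iC _ fg1.
have shC x : ci0 x -> ci0 (x + 1) by rewrite !inC; lra.
have {}b1 := b1 shC; have b2 := H1on_bounded_shift mC iC shC fg2.
have preS : (fun x => c + x) @^-1` `[c, +oo[ = ci0.
  by apply/seteqP; split => x; rewrite inC /= in_itv/= andbT; lra.
have preR : (fun x => c - x) @^-1` `[0, c] = `[0, c]%classic.
  by apply/seteqP; split => x; rewrite /= !in_itv/=; lra.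
have preT : (fun x => - c + x) @^-1` ci0 = `[c, +oo[%classic.
  by apply/seteqP; split => x /=; rewrite inC /= in_itv/= andbT; lra.
have sR : `[0, c] `<=` ci0.
  by move=> x; rewrite inC /= in_itv/= => /andP[].
have sS : `[c, +oo[ `<=` ci0.
  by move=> x; rewrite inC /= in_itv/= andbT; exact: le_trans.
have mS : measurable (`[c, +oo[%classic : set R) by [].
have iS : is_interval (`[c, +oo[%classic : set R) by exact: interval_is_interval.
have iI : is_interval (`[0, c]%classic : set R) by exact: interval_is_interval.
have hw1 : H1on ci0 (fun x => f1 (c + x)) (fun x => g1 (c + x)).
  by rewrite -preS; apply: H1on_shift => //; exact: H1on_sub fg1.
have hr : H1on `[0, c] (fun x => f1 (c - x)) (fun x => -1 * g1 (c - x)).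
  by rewrite -preR; apply: H1on_reflect => //; exact: H1on_sub fg1.
have ht : H1on `[c, +oo[ (fun x => f2 (- c + x)) (fun x => g2 (- c + x)).
  by rewrite -preT; apply: H1on_shift.
have join : f1 (c - c) = f2 (- c + c) by rewrite addNr subrr.
have hw2 := H1on_glue c0 hr ht join.
have total (k1 k2 : R -> R) : rint ci0 k1 -> rint ci0 k2 ->
    \int[leb]_(x in ci0) k1 (c + x) +
    \int[leb]_(x in ci0) glue c (fun x => k1 (c - x)) (fun x => k2 (- c + x)) x =
    \int[leb]_(x in ci0) k1 x + \int[leb]_(x in ci0) k2 x.
  move=> i1 i2.
  have i1R := rint_sub (measurable_itv _) mC sR i1.
  have i1S := rint_sub (measurable_itv _) mC sS i1.
  have [jS eS] := rint_comp (leb_preserving_shift c) mS i1S; rewrite preS in jS eS.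
  have [jR eR] := rint_comp (leb_preserving_reflect c) (measurable_itv _) i1R.
  rewrite preR in jR eR.
  have [jT eT] := rint_comp (leb_preserving_shift (- c)) mC i2; rewrite preT in jT eT.
  rewrite (Rint_glue c0 jR jT).2 eS eR eT.
  have -> : \int[leb]_(x in ci0) k1 x = \int[leb]_(x in ci0) glue c k1 k1 x.
    by apply: Rint_eq => x _; rewrite /glue; case: ifP.
  by rewrite (Rint_glue c0 i1R i1S).2; ring.
(* The first half-line keeps [f1] from [c] on; the second runs through [f1] backwards from [c] to
   [0] and continues with [f2]. Backwards the derivative changes sign, which its square does not
   see. *)
exists (fun x => f1 (c + x)), (fun x => g1 (c + x)),
  (glue c (fun x => f1 (c - x)) (fun x => f2 (- c + x))),
  (glue c (fun x => -1 * g1 (c - x)) (fun x => g2 (- c + x))).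
split; [exact: hw1|exact: hw2|by rewrite /glue c0 addr0 subr0|].
have [sf1 sg1 _] := fg1; have [sf2 sg2 _] := fg2.
split.
- rewrite /rmass -(total _ _ sf1.2 sf2.2); congr (_ + _).
  by apply: Rint_eq => x _; rewrite /glue; case: ifP.
- rewrite /rmass -(total _ _ sg1.2 sg2.2); congr (_ + _).
  by apply: Rint_eq => x _; rewrite /glue; case: ifP => // _; ring.
- rewrite /rpow -(total _ _ (rint_abspow mC p2 sf1 b1) (rint_abspow mC p2 sf2 b2)); congr (_ + _).
  by apply: Rint_eq => x _; rewrite /glue; case: ifP.
Qed.

End Gluing.

(** * The soliton on the line *)

Section SolitonOnLine.
Variable R : realType.
Local Notation leb := (@lebesgue_measure R).
Implicit Types (p lam m x y : R) (phi : R -> R).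

Lemma soliton1_profile p phi : 2 < p -> soliton1 p phi ->
  exists2 lam, 0 < lam & forall x, 0 <= x -> phi x = profile p lam x.
Proof.
move=> p2 [dphi [h [m1 [phi0 [phiN min]]]]].
have mT : measurable (@setT R) by exact: measurableT.
have iT : is_interval (@setT R) by [].
have hT := H1_int_H1on mT iT I h.
have bT (f g : R -> R) : H1on setT f g -> bounded_on setT f.
  by move=> fg; apply: H1on_bounded_shift fg.
have powT (f g : R -> R) : H1on setT f g -> rint setT (fun x => abspow p (f x)).
  by move=> fg; apply: rint_abspow => //; [case: fg|exact: bT fg].
have energyE (f g : R -> R) : H1on setT f g ->
    Renergy p f g = (rmass setT g / 2 - rpow p setT f / p)%:E.
  move=> fg; have [sf sg _] := fg; rewrite /Renergy rint_EFin//; last exact: sg.2.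
  have -> : (\int[leb]_x (`|f x| `^ p)%:E = (rpow p setT f)%:E)%E.
    by rewrite -rint_EFin//; exact: powT fg.
  by rewrite -!EFinM -EFinB; congr (_%:E); rewrite ![_^-1 * _]mulrC.
have massE (f g : R -> R) : H1on setT f g -> Rmass f = (rmass setT f)%:E.
  by move=> [sf _ _]; rewrite /Rmass rint_EFin//; exact: sf.2.
have Mphi : rmass setT phi = 1 by move: m1; rewrite (massE _ _ hT) => -[].
have B0 : 0 < rpow p setT phi.
  apply: (@Rint_gt0 R setT 0 1) => //.
  - exact: powT hT.
  - by move=> x _; exact: abspow_ge0.
  - by move=> x _; rewrite /abspow powR_gt0// normr_gt0 gt_eqF.
have [||X hX] := @profile_of_weak_solution R setT p
   ((rpow p setT phi - rmass setT dphi) / 1) (-1) phi dphi mT iT hT (fun _ _ => I) p2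
   (fun x _ => phi0 x).
- move=> e e0.
  have mC : measurable (@set_ci0 R) by exact: measurable_itv.
  have [X _ hX] := H1on_vanishes (H1on_sub mC mT (fun _ _ => I) hT) e0.
  by exists X => x /hX + _; rewrite gtr0_norm.
- apply: (@euler_lagrange R setT p phi dphi 1 (rmass setT dphi) (rpow p setT phi)) => //.
    exact: bT hT.
  move=> a b c e k ab bc _ _ k0; cbv zeta; set f' := fun x => _; set g' := fun x => _.
  have K (s t : R) : s + (t - s) = t by ring.
  rewrite Mphi !K => kM.
  have hf' : H1on setT f' g'.
    by apply: H1onD => //; apply: H1onZ => //; exact: H1on_tent.
  have hk := H1onZ k mT iT hf'.
  have := min _ _ (H1on_H1_int mT iT I hk).
  have [sf' sg' _] := hf'.
  rewrite (massE _ _ hk) rmassZ// kM => /(_ erefl).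
  rewrite !energyE// lee_fin rmassZ// rpowZ//; last exact: powT hf'.
  rewrite {1}/abspow gtr0_norm//; lra.
- set lam := _ / 1 in X hX *; have [y hy] := hX.
  exists lam => // x x0; rewrite hy; last by lra.
  have : profile p lam (1 + y) = profile p lam (-1 + y).
    by rewrite -!hy ?phiN//; lra.
  move=> /(profile_inj p2 X) e.
  suff -> : y = 0 by rewrite addr0.
  by move: e; case: (ger0P (1 + y)); case: (ger0P (-1 + y)); lra.
Qed.

(** Dilating by [r = m^((p-2)/(6-p))] multiplies the frequency by [r^2], so [r = sqrt (lam / lam1)]
    is wanted and determines [m]. The amplitude [m^(2/(6-p))] is then [r^(2/(p-2))], as the profile
    demands. *)
Lemma soliton_m_profile p phi lam1 lam : 2 < p < 6 -> 0 < lam1 -> 0 < lam ->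
  (forall x, 0 <= x -> phi x = profile p lam1 x) ->
  exists2 m, 0 < m & forall x, 0 <= x -> soliton_m p phi m x = profile p lam x.
Proof.
move=> /andP[p2 p6] l1 l0 phiE.
have q0 : 0 < lam / lam1 by rewrite divr_gt0.
have p6' : 6 - p != 0 by rewrite gt_eqF//; lra.
have p2' : p - 2 != 0 by rewrite gt_eqF//; lra.
have p0 : 0 < p by lra.
exists ((lam / lam1) `^ ((6 - p) / (2 * (p - 2)))); first exact: powR_gt0.
move=> x x0; rewrite /soliton_m -!powRrM.
have -> : (6 - p) / (2 * (p - 2)) * ((p - 2) / (6 - p)) = 2^-1.
  by field; rewrite p6' p2'.
have -> : (6 - p) / (2 * (p - 2)) * (2 / (6 - p)) = 2^-1 * ((p - 2) / 2)^-1.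
  by field; rewrite p6' p2'.
rewrite powRrM powR12_sqrt ?(ltW q0)//.
set r := Num.sqrt (lam / lam1); have r0 : 0 < r by rewrite sqrtr_gt0.
rewrite phiE; last by rewrite mulr_ge0// ltW.
rewrite /profile.
have rl : Num.sqrt lam1 * r = Num.sqrt lam.
  by rewrite -sqrtrM ?(ltW l1)// mulrC divfK// gt_eqF.
have s1 : 0 < Num.sqrt lam1 by rewrite sqrtr_gt0.
have sl : 0 < Num.sqrt lam by rewrite sqrtr_gt0.
have -> : (p - 2) / 2 * Num.sqrt lam1 * (r * x) = (p - 2) / 2 * Num.sqrt lam * x.
  by rewrite -rl; ring.
have sq l : 0 < l -> Num.sqrt (2 / (p * l)) = Num.sqrt (2 / p) / Num.sqrt l.
  move=> l00; rewrite -sqrtrV ?(ltW l00)// -sqrtrM ?divr_ge0 ?(ltW p0)//.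
  by congr Num.sqrt; field; rewrite !gt_eqF.
rewrite !sq// -rl.
set C := cosh2 _; set S := Num.sqrt (2 / p).
have S0 : 0 < S by rewrite sqrtr_gt0 divr_gt0.
have C0 : 0 < C by exact: cosh2_gt0.
have -> : S / (Num.sqrt lam1 * r) / 2 * C = r^-1 * (S / Num.sqrt lam1 / 2 * C).
  by field; rewrite !gt_eqF.
rewrite [RHS]powRM; last 2 first.
- by rewrite invr_ge0 ltW.
- by rewrite mulr_ge0 ?(ltW C0)// divr_ge0// divr_ge0// ltW.
congr (_ * _).
by rewrite -(powR_inv1 (ltW r0)) -powRrM mulN1r opprK.
Qed.

End SolitonOnLine.

(** * Ground states on the graph *)

Section Graph.
Variables (R : realType) (G : mgraph R).
Hypothesis lenG : forall e, 0 < len G e.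
Local Notation leb := (@lebesgue_measure R).
Local Notation ci0 := (@set_ci0 R).
Local Notation edge := ('I_(nB G) + 'I_(nH G))%type.

(** Bounded edges and half-lines share one finite index type, so that totals over the graph are
    single sums and one edge can be singled out uniformly. *)
Definition edom (i : edge) : set R :=
  match i with inl e => set_cc 0 (len G e) | inr _ => ci0 end.

Definition eval (u : gfun G) (i : edge) : R -> R :=
  match i with inl e => fB u e | inr h => fH u h end.

Definition of_edges (w : edge -> R -> R) : gfun G :=
  GFun (fun e => w (inl e)) (fun h => w (inr h)).

Definition matching (w : edge -> R -> R) (val : 'I_(nV G) -> R) :=
  (forall e, w (inl e) 0 = val (bsrc G e) /\ w (inl e) (len G e) = val (btgt G e)) /\
  (forall h, w (inr h) 0 = val (hsrc G h)).

Lemma measurable_edom i : measurable (edom i).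
Proof. by case: i => ?; exact: measurable_itv. Qed.

Lemma is_interval_edom i : is_interval (edom i).
Proof. by case: i => ?; exact: interval_is_interval. Qed.

Lemma edom0 i : edom i 0.
Proof. by case: i => ?; rewrite /edom /set_cc /set_ci0 /= in_itv/= lexx// ltW. Qed.

Lemma edom_segment i : exists2 b, 0 < b & `[0, b] `<=` edom i.
Proof.
case: i => [e|h]; first by exists (len G e).
by exists 1 => // x; rewrite /edom /set_ci0 /= !in_itv/= => /andP[->].
Qed.

Lemma H1on_edom_bounded i f g : H1on (edom i) f g -> bounded_on (edom i) f.
Proof.
case: i => [e|h]; first exact: H1on_bounded_cc.
apply: H1on_bounded_shift; [exact: measurable_itv|exact: interval_is_interval|].
by move=> x; rewrite /edom /set_ci0 /= !in_itv/= !andbT; lra.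
Qed.

Variable p : R.
Hypothesis p2 : 2 < p.

Definition tmass (w : edge -> R -> R) := \sum_i rmass (edom i) (w i).
Definition tpow (w : edge -> R -> R) := \sum_i rpow p (edom i) (w i).

Lemma gint_sum (F : R -> R) (w : edge -> R -> R) :
  (forall i, rint (edom i) (fun x => F (w i x))) ->
  gint F (of_edges w) = (\sum_i \int[leb]_(x in edom i) F (w i x))%:E.
Proof.
move=> Fi; rewrite big_sumType /gint EFinD -!sumEFin; congr (_ + _)%E.
  by apply: eq_bigr => e _; rewrite -(rint_EFin (measurable_edom (inl e)) (Fi (inl e))).
by apply: eq_bigr => h _; rewrite -(rint_EFin (measurable_edom (inr h)) (Fi (inr h))).
Qed.

Definition admissible (w dw : edge -> R -> R) :=
  (forall i, H1on (edom i) (w i) (dw i)) /\ exists val, matching w val.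

Lemma of_edges_eval (u : gfun G) : of_edges (eval u) = u.
Proof. by case: u. Qed.

Lemma gH1_admissible u du : gH1 u du -> admissible (eval u) (eval du).
Proof.
move=> [[val [vB vH]] [hB hH]]; split; last by exists val.
by move=> i; apply: H1_int_H1on; [exact: measurable_edom|exact: is_interval_edom|exact: edom0|case: i].
Qed.

Lemma admissible_gH1 w dw : admissible w dw -> gH1 (of_edges w) (of_edges dw).
Proof.
move=> [hw [val [vB vH]]].
have H i : H1_int (edom i) (w i) (dw i).
  by apply: H1on_H1_int; [exact: measurable_edom|exact: is_interval_edom|exact: edom0|exact: hw].
by split; [exists val|split=> [e|h]; [exact: (H (inl e))|exact: (H (inr h))]].
Qed.

Lemma admissible_rint_pow w dw : admissible w dw ->
  forall i, rint (edom i) (fun x => abspow p (w i x)).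
Proof.
move=> [hw _] i; apply: rint_abspow => //; first exact: measurable_edom.
  by case: (hw i).
exact: H1on_edom_bounded (hw i).
Qed.

Lemma gmass_of_edges w dw : admissible w dw -> gmass (of_edges w) = (tmass w)%:E.
Proof. by move=> [hw _]; apply: gint_sum => i; case: (hw i) => -[]. Qed.

Lemma genergy_of_edges w dw : admissible w dw ->
  genergy p (of_edges w) (of_edges dw) = (tmass dw / 2 - tpow w / p)%:E.
Proof.
move=> adm; rewrite /genergy (gint_sum (F := abspow p)); last exact: admissible_rint_pow adm.
rewrite (gint_sum (F := @sqr R)); last by move=> i; case: (adm.1 i) => _ [].
by rewrite -!EFinM -EFinB; congr (_%:E); rewrite ![_^-1 * _]mulrC.
Qed.

Variables (mu : R) (u du : gfun G).
Hypotheses (mu0 : 0 < mu) (gs : ground_state p mu u du) (upos : gpos u).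

Local Notation U := (eval u).
Local Notation dU := (eval du).

Lemma ground_state_admissible : admissible U dU.
Proof. by case: gs => /gH1_admissible. Qed.

Lemma ground_state_tmass : tmass U = mu.
Proof.
case: gs => _ [+ _]; rewrite -{1}(of_edges_eval u).
by rewrite (gmass_of_edges ground_state_admissible) => -[].
Qed.

Lemma ground_state_min w dw : admissible w dw -> tmass w = mu ->
  tmass dU / 2 - tpow U / p <= tmass dw / 2 - tpow w / p.
Proof.
move=> adm mw; have [_ [_ min]] := gs.
have := min _ _ (admissible_gH1 adm).
rewrite (gmass_of_edges adm) mw => /(_ erefl).
rewrite -{1}(of_edges_eval u) -{1}(of_edges_eval du).
by rewrite (genergy_of_edges ground_state_admissible) (genergy_of_edges adm) lee_fin.
Qed.

Lemma eval_gt0 i x : edom i x -> 0 < U i x.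
Proof.
case: i => [e|h]; rewrite /edom /set_cc /set_ci0 /= in_itv/= ?andbT; first exact: upos.1.
exact: upos.2.
Qed.

Lemma rmass_gt0 i : 0 < rmass (edom i) (U i).
Proof.
have [b b0 sb] := edom_segment i; have [sf _ _] := ground_state_admissible.1 i.
apply: (Rint_gt0 (measurable_edom i) sb b0) => //; first exact: sf.2.
  by move=> x _; exact: sqr_ge0.
move=> x x0b; rewrite exprn_gt0// eval_gt0//.
by apply: sb; rewrite /= in_itv.
Qed.

Lemma rpow_gt0 i : 0 < rpow p (edom i) (U i).
Proof.
have [b b0 sb] := edom_segment i.
apply: (Rint_gt0 (measurable_edom i) sb b0) => //.
- exact: admissible_rint_pow ground_state_admissible i.
- by move=> x _; exact: abspow_ge0.
- move=> x x0b; rewrite /abspow powR_gt0// normr_gt0 gt_eqF// eval_gt0//.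
  by apply: sb; rewrite /= in_itv.
Qed.

Definition update (w : edge -> R -> R) j f i := if i == j then f else w i.

Lemma sum_update (F : edge -> (R -> R) -> R) w j f :
  \sum_i F i (update w j f i) = \sum_i F i (w i) + (F j f - F j (w j)).
Proof.
rewrite (bigD1 j)//= (bigD1 j (P := predT) (F := fun i => F i (w i)))//= /update eqxx.
rewrite (eq_bigr (fun i => F i (w i))); first by ring.
by move=> i /negbTE ->.
Qed.

Lemma tmass_update w j f :
  tmass (update w j f) = tmass w + (rmass (edom j) f - rmass (edom j) (w j)).
Proof. exact: (sum_update (fun i => rmass (edom i))). Qed.

Lemma tpow_update w j f :
  tpow (update w j f) = tpow w + (rpow p (edom j) f - rpow p (edom j) (w j)).
Proof. exact: (sum_update (fun i => rpow p (edom i))). Qed.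

Lemma update_H1on w dw j f g : (forall i, H1on (edom i) (w i) (dw i)) ->
  H1on (edom j) f g -> forall i, H1on (edom i) (update w j f i) (update dw j g i).
Proof. by move=> hw hf i; rewrite /update; case: eqP => [->|]. Qed.

(** The Lagrange multiplier: pairing [u'' = lam u - u^(p-1)] with [u] over the graph formally gives
    [lam mu] as the integral of [u^p] minus that of [u'^2]. *)
Definition frequency := (tpow U - tmass dU) / mu.

Lemma scale_admissible k w dw : admissible w dw ->
  admissible (fun i x => k * w i x) (fun i x => k * dw i x).
Proof.
move=> [hw [val [vB vH]]]; split.
  by move=> i; apply: H1onZ => //; [exact: measurable_edom|exact: is_interval_edom].
exists (fun x => k * val x); split=> [e|h].
  by have [-> ->] := vB e.
by rewrite vH.
Qed.

Lemma tmassZ k w dw : admissible w dw -> tmass (fun i x => k * w i x) = k ^+ 2 * tmass w.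
Proof.
move=> [hw _]; rewrite /tmass mulr_sumr; apply: eq_bigr => i _.
by rewrite rmassZ//; [exact: measurable_edom|case: (hw i)].
Qed.

Lemma tmass_derZ k w dw : admissible w dw -> tmass (fun i x => k * dw i x) = k ^+ 2 * tmass dw.
Proof.
move=> [hw _]; rewrite /tmass mulr_sumr; apply: eq_bigr => i _.
by rewrite rmassZ//; [exact: measurable_edom|case: (hw i)].
Qed.

Lemma tpowZ k w dw : admissible w dw -> tpow (fun i x => k * w i x) = abspow p k * tpow w.
Proof.
move=> adm; rewrite /tpow mulr_sumr; apply: eq_bigr => i _.
by rewrite rpowZ//; [exact: measurable_edom|exact: admissible_rint_pow adm i].
Qed.

Lemma tpow_gt0 (j : edge) : 0 < tpow U.
Proof.
rewrite /tpow (bigD1 j)//= ltr_pwDl ?rpow_gt0//.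
by apply: sumr_ge0 => i _; exact: rpow_ge0.
Qed.

Lemma ground_state_half_line h : 0 < frequency /\
  exists y, forall x, 0 <= x -> fH u h x = profile p frequency (x + y).
Proof.
have adm := ground_state_admissible; pose j : edge := inr h.
have mC := measurable_edom j; have iC := @is_interval_edom j.
have hu : H1on ci0 (fH u h) (fH du h) by exact: (adm.1 j).
have u0 x : ci0 x -> 0 < fH u h x by exact: (@eval_gt0 j).
apply: (@profile_of_weak_solution R ci0 p frequency 0 _ _ mC iC hu) => //.
- by move=> x x0; rewrite /set_ci0 /= in_itv/= x0.
- move=> e /(H1on_vanishes hu)[X _ hX]; exists X => x Xx x0.
  by rewrite (le_trans (ler_norm _))// hX.
apply: (@euler_lagrange R ci0 p (fH u h) (fH du h) mu (tmass dU) (tpow U)) => //.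
- exact: (H1on_edom_bounded (i := j) hu).
- exact: (tpow_gt0 j).
move=> a b c e k ab bc Da Dc k0; cbv zeta; set f' := fun x => _; set g' := fun x => _.
move=> kM.
have a0 : 0 <= a by move: Da; rewrite /set_ci0 /= in_itv/= andbT.
have hf' : H1on (edom j) f' g'.
  by apply: H1onD => //; apply: H1onZ => //; exact: H1on_tent.
(* A tent in [[0, +oo)] vanishes at [0] even when [a = 0], so [val] still matches. *)
have f'0 : f' 0 = fH u h 0.
  rewrite /f'; have [an0|a_le0] := ltP 0 a.
    by rewrite tent_out ?mulr0 ?addr0// => /andP[]; rewrite leNgt an0.
  have -> : a = 0 by apply/le_anti; rewrite a_le0.
  have b0 : 0 <= b by lra.
  by rewrite (tent_l bc (lexx 0) b0) subrr mul0r mulr0 addr0.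
have adm' : admissible (update U j f') (update dU j g').
  have [hU [val [vB vH]]] := adm; split; first exact: update_H1on.
  exists val; split=> [e'|h']; first exact: vB.
  rewrite /update; case: eqP => [[->]|_]; last exact: vH.
  by rewrite f'0; exact: (vH h).
have min := ground_state_min (scale_admissible k adm').
rewrite (tmassZ k adm') (tmass_derZ k adm') (tpowZ k adm') in min.
rewrite !tmass_update tpow_update ground_state_tmass in min.
by have := min kM; rewrite /abspow (gtr0_norm k0) /=; lra.
Qed.

(** The minimizer is the point [t = s = 1]. Both power terms lie above their tangents at [1], the
    first strictly; what survives is twice the linear part of the change in energy. *)
Lemma concave_step (A B A' B' t s : R) : 0 < B -> 0 <= B' -> 0 < t -> t != 1 -> 0 <= s ->
  (A + A') / 2 - (B + B') / p <=
    (t * A + s * A') / 2 - (t `^ (p / 2) * B + s `^ (p / 2) * B') / p ->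
  0 < (t - 1) * (A - B) + (s - 1) * (A' - B').
Proof.
move=> B0 B0' t0 t1 s0.
have q1 : 1 < p / 2 by have := p2; lra.
have p0 : 0 < p by have := p2; lra.
have ht : (1 + p / 2 * (t - 1)) * B < t `^ (p / 2) * B.
  by rewrite ltr_pM2r//; exact: powR_bernoulli_lt.
have hs : (1 + p / 2 * (s - 1)) * B' <= s `^ (p / 2) * B'.
  by apply: ler_wpM2r => //; exact: powR_bernoulli.
set X := t `^ _ * B + _ in ht hs *.
have : ((1 + p / 2 * (t - 1)) * B + (1 + p / 2 * (s - 1)) * B') / p < X / p.
  by rewrite ltr_pM2r ?invr_gt0// /X; lra.
rewrite (_ : (_ + _) / p = (B + B') / p + ((t - 1) * B + (s - 1) * B') / 2); last first.
  by field; rewrite gt_eqF.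
move=> h1 h2; lra.
Qed.

(** * Exchange of mass between two half-lines and the rest of the graph *)

Section TwoHalfLines.
Variables (v : 'I_(nV G)) (ha hb : 'I_(nH G)).
Hypotheses (av : hsrc G ha = v) (bv : hsrc G hb = v) (ab : ha != hb).
Local Notation ja := (inr ha : edge).
Local Notation jb := (inr hb : edge).

Lemma sum_two (F : edge -> R) :
  \sum_i F i = F ja + F jb + \sum_(i | (i != ja) && (i != jb)) F i.
Proof.
rewrite (bigD1 ja)//= (bigD1 jb)/=; last by apply: contra ab => /eqP[->].
by rewrite addrA.
Qed.

(* With [t = 1 - d m'] and [s = 1 + d m] the total mass is constant, and
   minimality forces [0 < d Z] for every small [d != 0] of either sign. *)
Lemma half_line_le_vertex (j0 : edge) : j0 != ja -> j0 != jb ->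
  forall x, 0 <= x -> fH u ha x <= fH u ha 0.
Proof.
move=> j0a j0b xm xm0; rewrite leNgt; apply/negP => gtV.
have adm := ground_state_admissible; have [hU [val [vB vH]]] := adm.
set V := fH u ha 0 in gtV.
have Vval : V = val v by rewrite -av; exact: (vH ha).
have V0 : 0 < V by apply: upos.2.
have fa : H1on ci0 (fH u ha) (fH du ha) := hU ja.
have fb : H1on ci0 (fH u hb) (fH du hb) := hU jb.
have fab : fH u ha 0 = fH u hb 0 by rewrite -/V Vval -bv; exact/esym/(vH hb).
pose rest (F : edge -> R) := \sum_(i | (i != ja) && (i != jb)) F i.
pose m := rmass ci0 (fH u ha) + rmass ci0 (fH u hb).
pose m' := rest (fun i => rmass (edom i) (U i)).
pose A := rmass ci0 (fH du ha) + rmass ci0 (fH du hb).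
pose A' := rest (fun i => rmass (edom i) (dU i)).
pose B := rpow p ci0 (fH u ha) + rpow p ci0 (fH u hb).
pose B' := rest (fun i => rpow p (edom i) (U i)).
have m0 : 0 < m by rewrite addr_gt0//; [exact: (rmass_gt0 ja)|exact: (rmass_gt0 jb)].
have B0 : 0 < B by rewrite addr_gt0//; [exact: (rpow_gt0 ja)|exact: (rpow_gt0 jb)].
have B0' : 0 <= B' by apply: sumr_ge0 => i _; exact: rpow_ge0.
have m0' : 0 < m'.
  rewrite /m' /rest (bigD1 j0)/=; last by rewrite j0a.
  by rewrite ltr_pwDl ?rmass_gt0// sumr_ge0// => i _; exact: rmass_ge0.
have mm : m + m' = mu by rewrite -ground_state_tmass /tmass sum_two.
(* Half of [Z] is the derivative of the energy at [d = 0] along the exchange. *)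
pose Z := m * (A' - B') - m' * (A - B).
have key d : d != 0 -> 0 < 1 + d * m -> 0 < 1 - d * m' ->
    (exists2 c, 0 <= c & fH u ha c = Num.sqrt (1 + d * m) / Num.sqrt (1 - d * m') * V) ->
    0 < d * Z.
  move=> d0 s0 t0 [c c0 uc].
  have [w1 [d1 [w2 [d2 [hw1 hw2 [w10 w20] [em eA eB]]]]]] :=
    slide_two_half_lines p2 c0 fa fb fab.
  set s := 1 + d * m in s0 uc *; set t := 1 - d * m' in t0 uc *.
  have st0 : 0 < Num.sqrt t by rewrite sqrtr_gt0.
  pose w := update (update (fun i x => Num.sqrt s * U i x) jb (fun x => Num.sqrt t * w2 x))
    ja (fun x => Num.sqrt t * w1 x).
  pose dw := update (update (fun i x => Num.sqrt s * dU i x) jb (fun x => Num.sqrt t * d2 x))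
    ja (fun x => Num.sqrt t * d1 x).
  have [sU [valU [vBU vHU]]] := scale_admissible (Num.sqrt s) adm.
  have hw : admissible w dw.
    split.
      have hsa := H1onZ (Num.sqrt t) (measurable_edom ja) (@is_interval_edom ja) hw1.
      have hsb := H1onZ (Num.sqrt t) (measurable_edom jb) (@is_interval_edom jb) hw2.
      exact: (update_H1on (j := ja) (update_H1on (j := jb) sU hsb) hsa).
    exists (fun y => Num.sqrt s * val y); split=> [e|h].
      by have [<- <-] := vB e; split.
    (* The condition on [c] says exactly that the slid and rescaled line meets the rescaled rest of
       the graph at [v]. *)
    have fin : Num.sqrt t * fH u ha c = Num.sqrt s * val v.
      by rewrite uc Vval mulrA mulrCA divff ?mulr1// gt_eqF.
    rewrite /w /update; case: eqP => [[->]|_]; first by rewrite w10 fin av.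
    by case: eqP => [[->]|_]; [rewrite w20 fin bv|rewrite -(vH h)].
  have wa : w ja = (fun x => Num.sqrt t * w1 x) by rewrite /w /update eqxx.
  have wb : w jb = (fun x => Num.sqrt t * w2 x).
    by rewrite /w /update eqxx ifN// eq_sym; apply: contra ab => /eqP[->].
  have wr i : (i != ja) && (i != jb) -> w i = (fun x => Num.sqrt s * U i x).
    by move=> /andP[/negbTE ia /negbTE ib]; rewrite /w /update ia ib.
  have dwa : dw ja = (fun x => Num.sqrt t * d1 x) by rewrite /dw /update eqxx.
  have dwb : dw jb = (fun x => Num.sqrt t * d2 x).
    by rewrite /dw /update eqxx ifN// eq_sym; apply: contra ab => /eqP[->].
  have dwr i : (i != ja) && (i != jb) -> dw i = (fun x => Num.sqrt s * dU i x).
    by move=> /andP[/negbTE ia /negbTE ib]; rewrite /dw /update ia ib.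
  have [sw1 sd1 _] := hw1; have [sw2 sd2 _] := hw2.
  have mC := measurable_edom ja.
  have sqs : Num.sqrt s ^+ 2 = s by rewrite sqr_sqrtr// ltW.
  have sqt : Num.sqrt t ^+ 2 = t by rewrite sqr_sqrtr// ltW.
  have tM : tmass w = t * m + s * m'.
    rewrite /tmass sum_two wa wb.
    rewrite (rmassZ _ mC sw1) (rmassZ _ mC sw2) sqt -mulrDr em; congr (_ + _).
    rewrite mulr_sumr; apply: eq_bigr => i /wr ->; have [sUi _ _] := hU i.
    by rewrite (rmassZ _ (measurable_edom i) sUi) sqs.
  have tA : tmass dw = t * A + s * A'.
    rewrite /tmass sum_two dwa dwb.
    rewrite (rmassZ _ mC sd1) (rmassZ _ mC sd2) sqt -mulrDr eA; congr (_ + _).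
    rewrite mulr_sumr; apply: eq_bigr => i /dwr ->; have [_ sUi _] := hU i.
    by rewrite (rmassZ _ (measurable_edom i) sUi) sqs.
  have sqrt_pow z : 0 < z -> abspow p (Num.sqrt z) = z `^ (p / 2).
    move=> z0; rewrite /abspow ger0_norm ?sqrtr_ge0// -powR12_sqrt ?ltW// -powRrM.
    by rewrite mulrC.
  have pw1 : rint ci0 (fun x => abspow p (w1 x)).
    by apply: rint_abspow => //; exact: (H1on_edom_bounded (i := ja) hw1).
  have pw2 : rint ci0 (fun x => abspow p (w2 x)).
    by apply: rint_abspow => //; exact: (H1on_edom_bounded (i := jb) hw2).
  have tB : tpow w = t `^ (p / 2) * B + s `^ (p / 2) * B'.
    rewrite /tpow sum_two wa wb.
    rewrite (rpowZ _ mC pw1) (rpowZ _ mC pw2) (sqrt_pow t t0) -mulrDr eB; congr (_ + _).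
    rewrite mulr_sumr; apply: eq_bigr => i /wr ->.
    by rewrite (rpowZ _ (measurable_edom i) (admissible_rint_pow adm i)) (sqrt_pow s s0).
  have tmu : tmass w = mu by rewrite tM -mm /t /s; ring.
  have t1 : t != 1.
    by rewrite /t -subr_eq0 addrAC subrr add0r oppr_eq0 mulf_eq0 negb_or d0 gt_eqF.
  have ineq := ground_state_min hw tmu.
  rewrite tA tB /tmass /tpow !sum_two in ineq.
  have := @concave_step A B A' B' t s B0 B0' t0 t1 (ltW s0) ineq.
  by rewrite (_ : _ + _ = d * Z)// /Z /t /s; ring.
(* To the right of [xm] the function falls from [fH u ha xm] towards [0], so every value in between
   is attained. *)
have solve r : 0 < r -> r * V <= fH u ha xm -> exists2 c, 0 <= c & fH u ha c = r * V.
  move=> r0 rV; have rV0 : 0 < r * V by rewrite mulr_gt0.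
  have [X X0 hX] := H1on_vanishes fa rV0.
  pose Y := Num.max X xm.
  have XY : X <= Y by rewrite le_max lexx.
  have xY : xm <= Y by rewrite le_max lexx orbT.
  have ct : continuous (fun x : R => fH u ha (Num.max x 0)).
    apply: H1on_continuous_max fa _; [exact: (measurable_edom ja)|exact: (@is_interval_edom ja)|].
    by move=> x x0; rewrite /set_ci0 /= in_itv/= x0.
  have [||c] := @IVT R (fun x : R => fH u ha (Num.max x 0)) xm Y (r * V) xY.
  - exact: continuous_subspaceT.
  - have -> : Num.max xm 0 = xm by rewrite max_l.
    have -> : Num.max Y 0 = Y by rewrite max_l// (le_trans xm0).
    rewrite ge_min le_max rV andbT; apply/orP; right.
    by apply: le_trans (hX _ XY); exact: ler_norm.
  - rewrite in_itv/= => /andP[xc _]; rewrite max_l ?(le_trans xm0)// => e.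
    by exists c => //; exact: le_trans xc.
(* Small enough to keep [s] and [t] positive for both signs of [d]. *)
pose d1 := (2 * (m + m'))^-1.
have d10 : 0 < d1 by rewrite invr_gt0 mulr_gt0// addr_gt0.
have d1m : d1 * m < 1 by rewrite /d1 mulrC ltr_pdivrMr ?mul1r; lra.
have d1m' : d1 * m' < 1 by rewrite /d1 mulrC ltr_pdivrMr ?mul1r; lra.
have dm0 : 0 < d1 * m by rewrite mulr_gt0.
have dm0' : 0 < d1 * m' by rewrite mulr_gt0.
(* For negative [d] one has [s < 1 < t], so the value to reach is below [V]. *)
have Zneg : Z < 0.
  have s0 : 0 < 1 + - d1 * m by lra.
  have t0 : 0 < 1 - - d1 * m' by lra.
  have : 0 < - d1 * Z.
    apply: key => //; first by rewrite oppr_eq0 gt_eqF.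
    apply: solve; first by rewrite divr_gt0// sqrtr_gt0.
    apply: le_trans (ltW gtV); rewrite ler_piMl ?(ltW V0)//.
    by rewrite ler_pdivrMr ?sqrtr_gt0// mul1r ler_wsqrtr//; lra.
  by rewrite mulNr oppr_gt0 pmulr_rlt0.
pose q := (fH u ha xm / V) ^+ 2.
have uV : 1 < fH u ha xm / V by rewrite ltr_pdivlMr ?mul1r.
have q1 : 1 < q by rewrite /q expr2; nra.
have q0 : 0 < q by lra.
have den : 0 < m + q * m' by rewrite addr_gt0// mulr_gt0.
(* The second bound is [1 + d m <= q (1 - d m')] solved for [d]: the value to reach, now above [V],
   must not exceed [fH u ha xm]. *)
pose d2 := Num.min d1 ((q - 1) / (m + q * m')).
have d20 : 0 < d2 by rewrite lt_min d10 divr_gt0// subr_gt0.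
have d21 : d2 <= d1 by rewrite ge_min lexx.
have d2q : d2 * (m + q * m') <= q - 1 by rewrite -ler_pdivlMr// ge_min lexx orbT.
have d2m : d2 * m' <= d1 * m' by rewrite ler_pM2r.
have d2m0 : 0 < d2 * m by rewrite mulr_gt0.
have s0 : 0 < 1 + d2 * m by lra.
have t0 : 0 < 1 - d2 * m' by lra.
have : 0 < d2 * Z.
  apply: key => //; first by rewrite gt_eqF.
  apply: solve; first by rewrite divr_gt0// sqrtr_gt0.
  rewrite -ler_pdivlMr// ler_pdivrMr ?sqrtr_gt0//.
  rewrite -(gtr0_norm (lt_trans ltr01 uV)) -sqrtr_sqr -/q -sqrtrM ?(ltW q0)//.
  by rewrite ler_wsqrtr//; lra.
by rewrite pmulr_rgt0//; lra.
Qed.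
End TwoHalfLines.
End Graph.

(** With no other edge there are no bounded edges, so connectedness leaves [v] as the only vertex,
    of degree two: a line. *)
Lemma other_edge (R : realType) (G : mgraph R) (v : 'I_(nV G)) (ha hb : 'I_(nH G)) :
  (forall x y : 'I_(nV G), connect (@gadj R G) x y) -> ~ homeo_R G ->
  ha != hb -> hsrc G ha = v -> hsrc G hb = v ->
  exists2 i : 'I_(nB G) + 'I_(nH G), i != inr ha & i != inr hb.
Proof.
move=> conn nhR ab av bv; apply: contrapT => no.
have all_ab (i : 'I_(nB G) + 'I_(nH G)) : i = inr ha \/ i = inr hb.
  have [->|na] := eqVneq i (inr ha); first by left.
  have [->|nb] := eqVneq i (inr hb); first by right.
  by exfalso; apply: no; exists i.
have noB (e : 'I_(nB G)) : False by case: (all_ab (inl e)).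
have hab (h : 'I_(nH G)) : h = ha \/ h = hb.
  by case: (all_ab (inr h)) => -[->]; [left|right].
have cardH : nH G = 2%N.
  rewrite -(card_ord (nH G)) -cardsT.
  have -> : finset.setT = [set ha; hb]%SET.
    by apply/setP => h; rewrite !inE; case: (hab h) => ->; rewrite eqxx ?orbT.
  by rewrite cards2 ab.
have vv x : x = v.
  have /connectP[[|y s] //=] := conn x v.
  by move=> /andP[/existsP[e]]; case: (noB e).
apply: nhR; split=> // x; rewrite /gdeg.
have -> : #|[set e | bsrc G e == x]| = 0%N by apply: eq_card0 => e; case: (noB e).
have -> : #|[set e | btgt G e == x]| = 0%N by apply: eq_card0 => e; case: (noB e).
rewrite !add0n -[RHS]cardH -[RHS]card_ord; apply: eq_card => h.
by rewrite [RHS]inE; apply/idP; rewrite inE /=; case: (hab h) => ->; rewrite ?av ?bv (vv x).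
Qed.
Local Close Scope classical_set_scope.

Theorem theorem2p9 (R : realType) (p mu : R) (G : mgraph R) (v : 'I_(nV G))
    (phi1 : R -> R) (u du : gfun G) :
  2 < p < 6 -> 0 < mu ->
  is_metric_graph G -> ~ homeo_R G ->
  (2 <= #|[set h | hsrc G h == v]|)%N ->
  soliton1 p phi1 ->
  ground_state p mu u du ->
  gpos u ->
  exists m y : R, 0 < m /\ 0 <= y /\
    forall h : 'I_(nH G), hsrc G h = v ->
      forall x : R, 0 <= x -> fH u h x = soliton_m p phi1 m (x + y).
Proof.
move=> p26 mu0 [_ [lenG conn]] nhR /card_gt1P[ha [hb [+ + ab]]].
rewrite !inE => /eqP av /eqP bv sol gs upos.
have /andP[p2 p6] := p26.
have half := ground_state_half_line lenG p2 mu0 gs upos.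
set lam := frequency p mu u du in half.
have l0 : 0 < lam by case: (half ha).
have [lam1 l1 phiE] := soliton1_profile p2 sol.
have [m m0 mE] := soliton_m_profile p26 l1 l0 phiE.
have shift_ge0 h y : hsrc G h = v ->
    (forall x, 0 <= x -> fH u h x = profile p lam (x + y)) -> 0 <= y.
  move=> hv hy; rewrite leNgt; apply/negP => y0.
  have [h' h'v hh'] : exists2 h', hsrc G h' = v & h != h'.
    by have [->|nha] := eqVneq h ha; [exists hb|exists ha].
  have [i ih ih'] := other_edge conn nhR hh' hv h'v.
  have := half_line_le_vertex lenG p2 gs upos hv h'v hh' ih ih'.
  (* At [x = - y] the profile has its peak, strictly above its value at [v]. *)
  have ny : 0 <= - y by lra.
  move=> /(_ (- y) ny); rewrite !hy// add0r addNr leNgt.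
  by rewrite profile_lt// normr0 normr_gt0 lt_eqF.
have [[val [_ vH]] _] := gs.1.
have [_ [y hy]] := half ha.
have y0 := shift_ge0 ha y av hy.
exists m, y; split=> //; split=> // h hv x x0.
have [_ [z hz]] := half h; have z0 := shift_ge0 h z hv hz.
rewrite (mE _ (addr_ge0 x0 y0)) (hz _ x0); congr (profile p lam (x + _)).
have : profile p lam z = profile p lam y.
  by rewrite -[z]add0r -[y]add0r -hz// -hy// !vH hv av.
by move=> /(profile_inj p2 l0); rewrite !ger0_norm.
Qed.
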